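(* Let $G$ be a topological group. (1) If $G$ is locally compact and non-compact, then $G\notin\mathsf{TMD}$. (2) If $H\le G$ is a closed presyndetic subgroup, then $H\in\mathsf{TMD}$ if and only if $G\in\mathsf{TMD}$. (3) If $H\le G$ is a closed co-precompact subgroup and $H\in\mathsf{CMD}$, then $G\in\mathsf{CMD}$.
   Context: All topological spaces (and topological groups) are Hausdorff and regular. For a topological group $G$, a $G$-flow is a compact space with a continuous left $G$-action $G\times X\to X$; it is minimal if every orbit is dense. The universal minimal flow $\mathrm{M}(G)$ is the (unique up to isomorphism) minimal $G$-flow which admits a continuous $G$-equivariant map onto every minimal $G$-flow. For a symmetric open neighborhood $U$ of $e_G$ and a $G$-flow $X$, a nonempty open $A\subseteq X$ is $U$-TT if $A\subseteq\overline{UB}$ for every nonempty open $B\subseteq A$. $G\in\mathsf{TMD}$ ($G$ has tractable minimal dynamics) if for every symmetric open neighborhood $U$ of $e_G$, every nonempty open $A\subseteq\mathrm{M}(G)$ contains a nonempty open $U$-TT set. $G\in\mathsf{CMD}$ ($G$ has concrete minimal dynamics) if $\mathrm{M}(G)$ is $G$-finite: for every symmetric open neighborhood $U$ of $e_G$, every family $\mathcal{F}$ of nonempty open subsets of $\mathrm{M}(G)$ such that $\{UA:A\in\mathcal{F}\}$ is pairwise disjoint is finite. A closed subgroup $H\le G$ is presyndetic if for every neighborhood $U$ of $e_G$ there is a finite $F\subseteq G$ with $FUH=G$; it is co-precompact if for every neighborhood $U$ of $e_G$ there is a finite $F\subseteq G$ with $UFH=G$. *)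

(* Defs.v *)
From HB Require Import structures.
From mathcomp Require Import all_boot all_classical topology.

Set Implicit Arguments.
Unset Strict Implicit.
Unset Printing Implicit Defensive.

Local Open Scope classical_set_scope.
Local Open Scope group_scope.

HB.mixin Record PreTopologicalGroup_isTopologicalGroup G
    & Topological G & Group G := {
  mulg_continuous : continuous (fun x : G * G => x.1 * x.2);
  invg_continuous : continuous (fun x : G => x^-1)
}.

#[short(type="topologicalGroupType")]
HB.structure Definition TopologicalGroup :=
  {G of Topological G & Group G & PreTopologicalGroup_isTopologicalGroup G}.

Definition T3_space (T : topologicalType) :=
  hausdorff_space T /\ @regular_space T.

Record subgroup (G : groupType) := Subgroup {
  subgroup_set :> set G;
  subgroup1 : subgroup_set 1;
  subgroupM : forall x y,
    subgroup_set x -> subgroup_set y -> subgroup_set (x * y);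
  subgroupV : forall x, subgroup_set x -> subgroup_set x^-1
}.

(* The carrier of a subgroup, as a group in its own right; over a topological
   group it carries the subspace (initial) topology. *)
Definition subgroup_type (G : groupType) (H : subgroup G) : Type :=
  set_type H.

Section SubgroupGroup.
Context (G : groupType) (H : subgroup G).

HB.instance Definition _ := Choice.copy (subgroup_type H) (set_type H).

Definition subgroup_val (x : subgroup_type H) : G := set_val x.

Lemma subgroup_val_inj : injective subgroup_val.
Proof. exact: val_inj. Qed.

Lemma subgroup_valP (x : subgroup_type H) : (H : set G) (subgroup_val x).
Proof. exact: set_valP. Qed.

Definition to_subgroup (x : G) (Hx : (H : set G) x) : subgroup_type H :=
  exist (fun y => y \in (H : set G)) x (mem_set Hx).

Definition subgroup_one := to_subgroup (subgroup1 H).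

Definition subgroup_mul (x y : subgroup_type H) :=
  to_subgroup (subgroupM (subgroup_valP x) (subgroup_valP y)).

Definition subgroup_inv (x : subgroup_type H) :=
  to_subgroup (subgroupV (subgroup_valP x)).

Let mulA : associative subgroup_mul.
Proof. by move=> x y z; apply: subgroup_val_inj; exact: mulgA. Qed.

Let mul1 : left_id subgroup_one subgroup_mul.
Proof. by move=> x; apply: subgroup_val_inj; exact: mul1g. Qed.

Let mulr1 : right_id subgroup_one subgroup_mul.
Proof. by move=> x; apply: subgroup_val_inj; exact: mulg1. Qed.

Let mulV : left_inverse subgroup_one subgroup_inv subgroup_mul.
Proof. by move=> x; apply: subgroup_val_inj; exact: mulVg. Qed.

Let mulrV : right_inverse subgroup_one subgroup_inv subgroup_mul.
Proof. by move=> x; apply: subgroup_val_inj; exact: mulgV. Qed.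

HB.instance Definition _ :=
  isGroup.Build (subgroup_type H) mulA mul1 mulr1 mulV mulrV.

End SubgroupGroup.

Section SubgroupTopology.
Context (G : topologicalGroupType) (H : subgroup G).

HB.instance Definition _ := Topological.copy (subgroup_type H) (set_type H).

Lemma subgroup_val_continuous : continuous (@subgroup_val G H).
Proof. exact: initial_continuous. Qed.

Let continuous_subgroup (X : topologicalType) (f : X -> subgroup_type H) :
  continuous (fun x => subgroup_val (f x)) -> continuous f.
Proof. exact: continuous_comp_initial. Qed.

Let mulc : continuous (fun x : subgroup_type H * subgroup_type H => x.1 * x.2).
Proof.
apply: continuous_subgroup => x.
apply: (@continuous_comp _ _ _ (fun y : subgroup_type H * subgroup_type H =>
  (subgroup_val y.1, subgroup_val y.2)) (fun z : G * G => z.1 * z.2)).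
  apply: cvg_pair => /=.
  - apply: (@continuous_comp _ _ _ fst (@subgroup_val G H)); first exact: cvg_fst.
    exact: subgroup_val_continuous.
  - apply: (@continuous_comp _ _ _ snd (@subgroup_val G H)); first exact: cvg_snd.
    exact: subgroup_val_continuous.
exact: mulg_continuous.
Qed.

Let invc : continuous (fun x : subgroup_type H => x^-1).
Proof.
apply: continuous_subgroup => x.
apply: (@continuous_comp _ _ _ (@subgroup_val G H) (fun a : G => a^-1)).
  exact: subgroup_val_continuous.
exact: invg_continuous.
Qed.

HB.instance Definition _ :=
  PreTopologicalGroup_isTopologicalGroup.Build (subgroup_type H) mulc invc.

End SubgroupTopology.

Record flow (G : topologicalGroupType) := Flow {
  flow_space :> topologicalType;
  act : G -> flow_space -> flow_space;
  act1 : forall x, act 1 x = x;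
  actM : forall g h x, act (g * h) x = act g (act h x);
  act_continuous : continuous (fun p : G * flow_space => act p.1 p.2);
  flow_compact : compact [set: flow_space];
  flow_T3 : T3_space flow_space
}.

Section Flows.
Context (G : topologicalGroupType).
Implicit Types (X Y : flow G) (U : set G).

Definition flow_orbit X (x : X) : set X := [set act g x | g in [set: G]].

(* Without nonemptiness the empty flow would be minimal, and then no flow would
   map onto every minimal flow. *)
Definition minimal_flow X :=
  [set: X] !=set0 /\ forall x : X, dense (flow_orbit x).

Definition equivariant X Y (f : X -> Y) :=
  forall (g : G) (x : X), f (act g x) = act g (f x).

Definition universal_minimal_flow X :=
  minimal_flow X /\
  forall Y, minimal_flow Y ->
    exists f : X -> Y, [/\ continuous f, equivariant f & range f = [set: Y]].

Definition symmetric_open_nbhs1 U :=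
  [/\ open U, U 1 & forall g, U g -> U g^-1].

Definition act_set X U (A : set X) : set X :=
  [set act g x | g in U & x in A].

Definition topologically_transitive X U (A : set X) :=
  [/\ open A, A !=set0 &
    forall B : set X, open B -> B !=set0 -> B `<=` A ->
      A `<=` closure (act_set U B)].

Definition densely_TT X :=
  forall U, symmetric_open_nbhs1 U ->
  forall A : set X, open A -> A !=set0 ->
  exists2 B : set X, B `<=` A & topologically_transitive U B.

(* The disjointness is that of the family indexed by F: distinct A, B in F have
   disjoint U A and U B. *)
Definition G_finite X :=
  forall U, symmetric_open_nbhs1 U ->
  forall F : set (set X),
    (forall A, F A -> open A /\ A !=set0) ->
    trivIset F (act_set U) ->
    finite_set F.

End Flows.

(* M(G) exists and is unique up to isomorphism, so a property of "the" universal
   minimal flow is stated as the existence of one that has it. *)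
Definition TMD (G : topologicalGroupType) :=
  exists2 M : flow G, universal_minimal_flow M & densely_TT M.

Definition CMD (G : topologicalGroupType) :=
  exists2 M : flow G, universal_minimal_flow M & G_finite M.

Section Subsets.
Context (G : topologicalGroupType).
Implicit Types A B H : set G.

Definition mul_set A B : set G := [set a * b | a in A & b in B].

Definition presyndetic H :=
  forall U : set G, nbhs 1 U ->
  exists2 F : set G, finite_set F & mul_set (mul_set F U) H = [set: G].

Definition coprecompact H :=
  forall U : set G, nbhs 1 U ->
  exists2 F : set G, finite_set F & mul_set (mul_set U F) H = [set: G].

End Subsets.

(* Main.v *)
Require Import Defs.
From HB Require Import structures.
From mathcomp Require Import all_boot all_classical topology.

(** Everything goes through the greatest ambit S(G), the Samuel compactification
    of G for the uniformity whose entourages are y x^-1 \in V.  Its points are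
    the maximal round filters on G, and its one decisive property is
    [samuel_separate]: if W S misses T for some neighbourhood W of 1, then S and
    T have disjoint closures in S(G).  Hence the orbit map of a point of a flow
    extends to S(G), so a minimal subflow of S(G) is a universal minimal flow.
    The same argument applied to a subgroup H, whose uniformity is induced by
    that of G, shows that a minimal H-subflow of the closure of H in S(G) is a
    universal minimal H-flow ([samuel_universal_minimal]).

    Being densely TT, and being G-finite, pass to factors.  As M(G) exists, G is
    in TMD (resp. CMD) if and only if every minimal G-flow is densely TT (resp.
    G-finite): [TMD_iff_minimal], [CMD_iff_minimal].  So one can work with
    convenient minimal flows.

    Co-precompact subgroups.  Let X be a minimal G-flow and N an H-minimal
    subset.  Given open sets A_i with pairwise disjoint U A_i, write G = V F H with V small: every A_i
    meets V f N for some f in the finite set F.  For a fixed f, the traces on N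
    of f^-1 V A_i form a family to which H-finiteness of N applies
    ([G_finite_coprecompact]).

    Presyndetic subgroups.  For H presyndetic, X a minimal G-flow, N an H-minimal
    subset of X and A open meeting N, the closure of V (N \cap A) has nonempty interior, because
    finitely many translates of V (N \cap A) have a dense union
    ([presyndetic_interior]).  If H is in TMD, then N contains relatively open
    TT sets, and such an interior turns them into TT sets of X
    ([presyndetic_densely_TT]).  Conversely let G be in TMD.  Presyndeticity
    makes the closure of H in S(G) meet a minimal subflow X of S(G)
    ([presyndetic_meets]), so that a universal minimal H-flow N sits inside X.
    Transferring TT sets of X to N bounds closures in X of sets U D with D open
    in N and U a neighbourhood in G ([presyndetic_ambient_TT]), whereas what is
    needed are closures in N of sets (U \cap H) D.  An idempotent of N gives a
    retraction of the closure of H onto N, by which open subsets of N are pulled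
    back to subsets of H; on these [samuel_separate] shows that nothing is lost
    ([densely_TT_of_ambient]).

    Locally compact groups.  If V is a neighbourhood of 1 contained in a compact
    set K, a V-TT set is contained in K x for each of its points x; by
    minimality M(G) = F K x with F finite.  But an element g outside a fixed
    compact set fixes no point of S(G), hence none of M(G): by a greedy colouring
    G is a finite union of sets V P which g moves away from themselves
    ([displaced_cover], [samuel_free]).  So the stabiliser of x is contained in
    a compact set, and G itself is compact. *)

Set Implicit Arguments.
Unset Strict Implicit.
Unset Printing Implicit Defensive.

Local Open Scope classical_set_scope.
Local Open Scope group_scope.

(** * Topological preliminaries *)

(** Phrased with neighbourhoods indexed by an arbitrary type: the covers used
    below are indexed by the elements of a group. *)
Lemma compact_finite_cover (T : topologicalType) (K : set T) (I : Type)
    (f : I -> set T) :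
  compact K -> (forall x, K x -> exists i, nbhs x (f i)) ->
  exists2 F : set I, finite_set F & forall x, K x -> exists2 i, F i & f i x.
Proof.
move=> /compact_near_coveringP cK Kf.
pose B F0 := [set F : set I | finite_set F /\ F0 `<=` F].
have FF : Filter (filter_from finite_set B).
  apply: filter_from_filter; first by exists set0; exact: finite_set0.
  move=> A C fA fC; exists (A `|` C); first by rewrite finite_setU.
  by move=> F [fF sAC]; split; split=> // i ?; apply: sAC; [left|right].
have [x Kx|F0 fF0 sF0] := cK _ _ (fun F x => exists2 i, F i & f i x) FF.
  have [i fi] := Kf x Kx; exists (f i, B [set i]).
    by split=> //=; exists [set i] => //; exact: finite_set1.
  by move=> [y F] /= [fy [_ iF]]; exists i => //; exact: iF.
by exists F0 => // x Kx; exact: (sF0 F0 (conj fF0 (fun _ h => h)) x Kx).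
Qed.

(** Zorn's lemma for nonempty closed sets of a compact space: a chain has
    nonempty intersection by compactness, so [P] only has to be stable under
    such intersections.  It yields minimal subflows as well as minimal closed
    subsemigroups. *)
Lemma chain_minimal (T : topologicalType) (P : set (set T)) (Y : set T) :
    compact [set: T] -> P Y -> (forall A, P A -> closed A /\ A !=set0) ->
    (forall F : set (set T), F !=set0 -> F `<=` P ->
      closed (\bigcap_(A in F) A) -> \bigcap_(A in F) A !=set0 ->
      P (\bigcap_(A in F) A)) ->
  exists2 N, P N /\ N `<=` Y & forall A, P A -> A `<=` N -> A = N.
Proof.
move=> cT PY Pcl PI.
(* The complements of the members of [P] contained in [Y] are closed under unions
   of nonempty chains; the empty set is added for the union of no set at all. *)
pose Q := [set O : set T | O = set0 \/ (P (~` O) /\ ~` O `<=` Y)].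
have [F FQ Ftot|O [QO Omax]] := @Zorn_bigcup T Q.
  have [[O0 FO0 O0n0]|Fall0] :=
      pselect (exists2 O0, F O0 & O0 <> set0); last first.
    left; apply/seteqP; split=> // x [O FO Ox]; apply: Fall0.
    by exists O => // O0; rewrite O0 in Ox.
  pose F' := [set A | F (~` A) /\ P A /\ A `<=` Y].
  have F'O0 : F' (~` O0).
    by rewrite /F' /= setCK; have [|[]] := FQ _ FO0.
  have E : ~` (\bigcup_(O in F) O) = \bigcap_(A in F') A.
    apply/seteqP; split=> x.
      by move=> nx A [FA _]; apply: contrapT => nA; apply: nx; exists (~` A).
    move=> Ix [O FO Ox]; have [O0'|[PO OY]] := FQ _ FO.
      by rewrite O0' in Ox.
    by apply: (Ix (~` O)) => //; rewrite /F' /= setCK.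
  right; rewrite E; split; last by move=> x Ix; have [_ [_]] := F'O0; apply; exact: Ix.
  have clI : closed (\bigcap_(A in F') A).
    by apply: closed_bigI => A [_ [/Pcl []]].
  apply: PI => //; [by exists (~` O0)|by move=> A [_ []]|].
  pose B A := A : set T.
  have FF : ProperFilter (filter_from F' B).
    apply: filter_from_proper; last by move=> A [_ [/Pcl []]].
    apply: filter_from_filter; first by exists (~` O0).
    move=> A C F'A F'C; have [FA _] := F'A; have [FC _] := F'C.
    have [sAC|sCA] := Ftot _ _ FA FC.
      by exists C => // x Cx; split=> //; apply: contrapT => /sAC.
    by exists A => // x Ax; split=> //; apply: contrapT => /sCA.
  have [|x [_ clx]] := cT _ FF; first by exists (~` O0).
  exists x => A F'A; have [_ [/Pcl [clA _] _]] := F'A; apply: clA => C nC.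
  by apply: clx => //; exists A.
have QY : Q (~` Y) by right; rewrite setCK; split.
have [PO OY] : P (~` O) /\ ~` O `<=` Y.
  case: QO => [O0|//]; rewrite O0 setC0.
  have [YT|nYT] := pselect (Y = setT); first by rewrite -YT; split.
  exfalso; apply: (Omax (~` Y)) => //; rewrite O0; split=> //.
  move=> h; apply: nYT; apply/seteqP; split=> // x _; apply: contrapT => nx.
  exact: (h x nx).
exists (~` O) => // A PA AO; apply: contrapT => nAO.
apply: (Omax (~` A)); last first.
  by right; rewrite setCK; split=> //; exact: subset_trans OY.
split; first by move=> x Ox Ax; exact: (AO x Ax).
move=> h; apply: nAO; apply/seteqP; split=> // x Ox.
by apply: contrapT => nAx; apply: Ox; exact: h.
Qed.

Lemma compact_T3 (T : topologicalType) :
  hausdorff_space T -> compact [set: T] -> T3_space T.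
Proof.
move=> hT cT; split=> // x A nA.
by have [B nB BA] := compact_regular hT cT (filterT : nbhs x setT) nA; exists B.
Qed.

Lemma hausdorff_separate (T : topologicalType) (x y : T) : hausdorff_space T ->
  x <> y -> exists2 A, nbhs x A & exists2 B, nbhs y B & forall z, A z -> B z -> False.
Proof.
rewrite open_hausdorff => /(_ x y) h /eqP/h [[A B] /= []].
rewrite !inE => Ax By [oA oB AB0].
exists A; first exact: open_nbhs_nbhs.
exists B; first exact: open_nbhs_nbhs.
by move=> z Az Bz; have : set0 z by rewrite -AB0.
Qed.

Lemma closed_eq_fun (T Y : topologicalType) (f g : T -> Y) :
  hausdorff_space Y -> continuous f -> continuous g ->
  closed [set x | f x = g x].
Proof.
move=> hY cf cg x clx; apply: contrapT => /(hausdorff_separate hY).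
move=> [A nA [B nB AB]].
have nfA : nbhs x (f @^-1` A) by exact: cf.
have ngB : nbhs x (g @^-1` B) by exact: cg.
have [y [/= fg [Ay By]]] := clx _ (filterI nfA ngB).
by apply: AB Ay _; rewrite fg.
Qed.

Lemma finite_bigcap_nbhs (T : topologicalType) (x : T) (I : choiceType)
    (F : set I) (f : I -> set T) : finite_set F ->
  (forall i, F i -> nbhs x (f i)) -> nbhs x (\bigcap_(i in F) f i).
Proof. by move=> /finite_fsetP [s ->] h; apply: filter_bigI. Qed.

Section SetType.
Context (T : topologicalType) (N : set T).

Lemma set_type_nbhs (x : set_type N) (A : set (set_type N)) : nbhs x A <->
  exists2 B, nbhs (set_val x) B & forall y, B (set_val y) -> A y.
Proof.
split=> [[_ [[B oB <-] Bx BA]]|[B nB BA]].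
  by exists B; [exact: open_nbhs_nbhs|].
by apply: filterS BA _; apply: initial_continuous.
Qed.

Lemma set_type_open (A : set (set_type N)) : open A <->
  exists2 B, open B & A = set_val @^-1` B.
Proof. by split=> [[B oB <-]|[B oB ->]]; exists B. Qed.

Lemma set_type_compact : compact N -> compact [set: set_type N].
Proof.
move=> cN F FF _.
have [|x [Nx clx]] := cN (set_val @ F) _.
  by apply: (@filterS _ F _ setT) => [x _|]; [exact: set_valP|exact: filterT].
exists (exist (fun y => y \in N) x (mem_set Nx)); split=> // A B FA.
move=> /set_type_nbhs [C nC CB].
have [|_ [[y Ay <-] Cy]] := clx (set_val @` A) C _ nC.
  by apply: (@filterS _ F _ A) => // y Ay; exists y.
by exists y; split=> //; exact: CB.
Qed.

Lemma set_type_hausdorff : hausdorff_space T -> hausdorff_space (set_type N).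
Proof.
move=> hT x y clxy; apply: val_inj; apply: hT => A B nA nB.
have [||z [Az Bz]] := clxy (set_val @^-1` A) (set_val @^-1` B).
- exact: initial_continuous.
- exact: initial_continuous.
by exists (set_val z).
Qed.

End SetType.

(** * Neighbourhoods of the identity *)
Section Nbhs1.
Context (G : topologicalGroupType).
Implicit Types (U V : set G) (g : G).

Lemma symmetric_open_nbhs U : symmetric_open_nbhs1 U -> nbhs 1 U.
Proof. by move=> [oU U1 _]; apply: open_nbhs_nbhs. Qed.

Lemma mulg_nbhs g h U : nbhs (g * h) U ->
  exists2 V, nbhs g V & exists2 W, nbhs h W & forall a b, V a -> W b -> U (a * b).
Proof.
move=> /(@mulg_continuous G (g, h))/= [[V W] /= [nV nW] VW].
by exists V => //; exists W => // a b Va Wb; apply: (VW (a, b)).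
Qed.

Lemma nbhs1_mul U : nbhs 1 U ->
  exists2 V, symmetric_open_nbhs1 V & forall a b, V a -> V b -> U (a * b).
Proof.
rewrite -{1}[1](mulg1 1) => /mulg_nbhs [V nV [W nW VW]].
pose O := interior (V `&` W).
have nO : O 1 by apply: filterI.
have oO : open O by exact: open_interior.
exists (O `&` (fun g => g^-1) @^-1` O).
  split; first by apply: openI => //; apply: open_comp => // x _; exact: invg_continuous.
    by split=> //=; rewrite invg1.
  by move=> g [Og Ogi]; split=> //=; rewrite invgK.
by move=> a b [/interior_subset [Va _] _] [/interior_subset [_ Wb] _]; exact: VW.
Qed.

Lemma nbhs1_sym U : nbhs 1 U ->
  exists2 V, symmetric_open_nbhs1 V & V `<=` U.
Proof.
move=> /nbhs1_mul [V sV VU]; exists V => // v Vv; rewrite -(mulg1 v).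
by apply: VU => //; case: sV.
Qed.

Lemma nbhs1_root U : symmetric_open_nbhs1 U ->
  exists V, [/\ symmetric_open_nbhs1 V, V `<=` U &
    forall a b, V a -> V b -> U (a * b)].
Proof.
move=> /symmetric_open_nbhs/nbhs1_mul [V sV VU]; exists V; split=> // v Vv.
by rewrite -(mulg1 v); apply: VU => //; case: sV.
Qed.

Lemma symmetric_open_nbhs1I U V : symmetric_open_nbhs1 U ->
  symmetric_open_nbhs1 V -> symmetric_open_nbhs1 (U `&` V).
Proof.
move=> [oU U1 sU] [oV V1 sV]; split; [exact: openI|by []|].
by move=> g [/sU Ug /sV Vg].
Qed.

Lemma nbhs_mulgl g h U : nbhs h U -> nbhs (g^-1 * h) [set x | U (g * x)].
Proof.
rewrite -{1}(mulVKg g h) => /mulg_nbhs [V nV [W nW VW]].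
by apply: filterS nW => w Ww; apply: VW => //; exact: nbhs_singleton nV.
Qed.

Lemma nbhs_mulgr g h U : nbhs h U -> nbhs (h * g^-1) [set x | U (x * g)].
Proof.
rewrite -{1}(mulgVK g h) => /mulg_nbhs [V nV [W nW VW]].
by apply: filterS nV => v Vv; apply: VW => //; exact: nbhs_singleton nW.
Qed.

Lemma nbhs1_conj g U : nbhs 1 U -> nbhs 1 [set v | U (g * v * g^-1)].
Proof.
move=> /(nbhs_mulgr g^-1); rewrite invgK mul1g.
by move=> /(nbhs_mulgl g); rewrite mulVg.
Qed.

Lemma symmetric_open_conj g U : symmetric_open_nbhs1 U ->
  symmetric_open_nbhs1 [set v | U (g * v * g^-1)].
Proof.
move=> [oU U1 sU]; split.
- rewrite openE => v /= Uv; have := nbhs_mulgl g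
    (nbhs_mulgr g^-1 (open_nbhs_nbhs (conj oU Uv))).
  by rewrite invgK mulgVK mulKg.
- by rewrite /= mulg1 mulgV.
- by move=> v /= /sU; rewrite !invgM invgK mulgA.
Qed.

End Nbhs1.

(** * Flows and minimal sets *)
Section FlowBasics.
Context (G : topologicalGroupType) (X : flow G).
Implicit Types (U V W : set G) (g : G) (x y : X) (A B D : set X).

Lemma actK g x : act g^-1 (act g x) = x.
Proof. by rewrite -actM mulVg act1. Qed.

Lemma actVK g x : act g (act g^-1 x) = x.
Proof. by rewrite -actM mulgV act1. Qed.

Lemma act_nbhs g x A : nbhs (act g x) A ->
  exists2 V, nbhs g V & exists2 B, nbhs x B & forall h y, V h -> B y -> A (act h y).
Proof.
move=> /(@act_continuous G X (g, x))/= [[V W] /= [nV nW] VW].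
by exists V => //; exists W => // a b Va Wb; apply: (VW (a, b)).
Qed.

Lemma continuous_act g : continuous (@act G X g).
Proof.
move=> x A /act_nbhs [V nV [B nB VB]]; apply: filterS nB => y By /=.
by apply: VB => //; exact: nbhs_singleton nV.
Qed.

Lemma nbhs_act g x A : nbhs x A -> nbhs (act g x) [set y | A (act g^-1 y)].
Proof.
by move=> nA; have := @continuous_act g^-1 (act g x) A; rewrite actK; exact.
Qed.

Lemma open_act_set U A : open A -> open (act_set U A).
Proof.
move=> oA; rewrite openE => _ [g Ug [x Ax <-]].
have nA : nbhs x A by exact: open_nbhs_nbhs.
apply: filterS (nbhs_act g nA) => y Ay.
by exists g => //; exists (act g^-1 y) => //; rewrite actVK.
Qed.

Lemma act_setS U V A B : U `<=` V -> A `<=` B -> act_set U A `<=` act_set V B.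
Proof.
by move=> UV AB _ [g /UV Vg [x /AB Bx <-]]; exists g => //; exists x.
Qed.

Lemma act_set_closure U A : act_set U (closure A) `<=` closure (act_set U A).
Proof.
move=> _ [g Ug [x clx <-]] B nB.
have [y [Ay By]] := clx _ (@continuous_act g x _ nB).
by exists (act g y); split=> //; exists g => //; exists y.
Qed.

Lemma act_setM U V W A : (forall a b, V a -> W b -> U (a * b)) ->
  act_set V (act_set W A) `<=` act_set U A.
Proof.
move=> VW _ [g Vg [_ [h Wh [x Ax <-]] <-]]; exists (g * h); first exact: VW.
by exists x => //; rewrite actM.
Qed.

Lemma closure_sub A B : closed B -> A `<=` B -> closure A `<=` B.
Proof. by move=> cB /closureS AB x /AB /cB. Qed.

(** How errors accumulate: passing to closures inside the small translations is
    harmless, so chains of closures only cost a product of neighbourhoods. *)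
Lemma act_set_closureM U V W A : (forall a b, V a -> W b -> U (a * b)) ->
  closure (act_set V (closure (act_set W A))) `<=` closure (act_set U A).
Proof.
move=> VW; apply: closure_sub; first exact: closed_closure.
apply: subset_trans (@act_set_closure _ _) _.
by apply: closureS; exact: act_setM.
Qed.

Lemma meet_act_set V A B : (forall g, V g -> V g^-1) ->
  act_set V A `&` B !=set0 -> act_set V B `&` A !=set0.
Proof.
move=> sV [_ [[g Vg [x Ax <-]] Bgx]]; exists x; split=> //.
by exists g^-1; [exact: sV|exists (act g x) => //; rewrite actK].
Qed.

Lemma closure_meet_open A B x : closure A x -> open B -> B x -> A `&` B !=set0.
Proof. by move=> cA oB Bx; apply: cA; exact: open_nbhs_nbhs. Qed.

Lemma closed_act_set (F : set G) D :
  finite_set F -> closed D -> closed (act_set F D).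
Proof.
move=> fF cD.
rewrite (_ : act_set _ _ = \bigcup_(f in F) (act f^-1 @^-1` D)).
  apply: closed_bigcup => // f _; apply: preimage_closed => //.
  by move=> x _; exact: continuous_act.
apply/seteqP; split=> x.
  by move=> [f Ff [d Dd <-]]; exists f => //=; rewrite actK.
by move=> [f Ff Dx]; exists f => //; exists (act f^-1 x) => //; rewrite actVK.
Qed.

(** Finitely many closed sets with empty interior do not cover a nonempty space,
    and the translates of the closure of [D] all have empty interior if it has. *)
Lemma interior_closure_translate (F : set G) D :
  finite_set F -> [set: X] !=set0 ->
  (forall x, closure (act_set F D) x) -> interior (closure D) !=set0.
Proof.
move=> fF [x0 _] FD; apply: contrapT => D0.
suff [y ny] : ~` (act_set F (closure D)) `&` setT !=set0.
  have clFD := closed_act_set fF (@closed_closure _ D).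
  case: ny => + _; apply; apply: clFD; apply: closureS (FD y).
  by apply: act_setS => //; exact: subset_closure.
have key : forall s : seq G, dense (~` (act_set [set` s] (closure D))).
  elim=> [|f s IH] O O0 oO.
    by case: O0 => o Oo; exists o; split=> // -[f].
  have [p [Op np]] := IH _ O0 oO.
  pose O' := O `&` ~` (act f^-1 @^-1` closure D).
  have oO' : open O'.
    apply: openI => //; apply: closed_openC; apply: preimage_closed.
      by move=> x _; exact: continuous_act.
    exact: closed_closure.
  have O'0 : O' !=set0.
    apply: contrapT => nO'; apply: D0; exists (act f^-1 p).
    have nb := open_nbhs_nbhs (conj oO Op).
    have := nbhs_act f^-1 nb; apply: filterS => y; rewrite /= invgK => Oy.
    by apply: contrapT => ny; apply: nO'; exists (act f y); split=> //=; rewrite actK.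
  have [q [[Oq nfq] nq]] := IH _ O'0 oO'.
  exists q; split=> // -[h /=]; rewrite inE => /orP [/eqP ->|hs] [d Dd dq].
    by apply: nfq; rewrite /= -dq actK.
  by apply: nq; exists h => //; exists d.
have [s Fs] := (finite_seqP F).1 fF; rewrite Fs.
have [||y [_ ny]] := key s setT; [by exists x0|exact: openT|].
by exists y.
Qed.

Definition act_invariant (Y : set X) := forall g x, Y x -> Y (act g x).

Lemma act_invariantV (Y : set X) g x : act_invariant Y -> Y (act g x) -> Y x.
Proof. by move=> iY /(iY g^-1); rewrite actK. Qed.

Lemma invariant_closure Y : act_invariant Y -> act_invariant (closure Y).
Proof.
move=> iY g x clx B nB; have [y [Yy By]] := clx _ (@continuous_act g x _ nB).
by exists (act g y); split=> //; exact: iY.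
Qed.

Lemma invariant_orbit x : act_invariant (flow_orbit x).
Proof. by move=> g _ [h _ <-]; exists (g * h) => //; rewrite actM. Qed.

Lemma orbit_closure_sub (Y : set X) x : closed Y -> act_invariant Y -> Y x ->
  closure (flow_orbit x) `<=` Y.
Proof. by move=> cY iY Yx; apply: closure_sub => // _ [g _ <-]; exact: iY. Qed.

Definition minimal_set (N : set X) :=
  [/\ closed N, N !=set0, act_invariant N &
    forall x, N x -> N `<=` closure (flow_orbit x)].

Lemma exists_minimal_set Y : closed Y -> Y !=set0 -> act_invariant Y ->
  exists2 N, minimal_set N & N `<=` Y.
Proof.
move=> cY Y0 iY.
pose P : set (set X) := [set A | [/\ closed A, A !=set0 & act_invariant A]].
have [| | | |N [[cN N0 iN] NY] Nmin] := @chain_minimal X P Y.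
- exact: flow_compact.
- by [].
- by move=> A [].
- move=> F F0 FP cI I0; split=> // g x Ix A FA.
  by have [_ _] := FP _ FA; apply; exact: Ix.
exists N => //; split=> // x Nx; rewrite [X in _ `<=` X](Nmin (closure (flow_orbit x))) //.
  split; [exact: closed_closure| |exact/invariant_closure/invariant_orbit].
  by exists x; apply: subset_closure; exists 1 => //; rewrite act1.
exact: orbit_closure_sub.
Qed.

Lemma minimal_set_setT : minimal_flow X <-> minimal_set [set: X].
Proof.
split=> [[X0 dX]|[_ X0 _ mX]].
  split=> // x _ y _ B nB.
  have := dX x (interior B).
  case; [by exists y|exact: open_interior|move=> z [/interior_subset Bz oz]].
  by exists z.
split=> // x O [y Oy] oO; have [z [oz Oz]] := closure_meet_open (mX x I y I) oO Oy.
by exists z.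
Qed.

Lemma minimal_set_cover N A : minimal_set N -> open A -> N `&` A !=set0 ->
  exists2 F : set G, finite_set F & forall x, N x -> exists2 f, F f & A (act f x).
Proof.
move=> [cN _ iN mN] oA [a [Na Aa]].
have cptN : compact N by apply: subclosed_compact (@flow_compact _ X) _.
have [x Nx|F fF FN] := compact_finite_cover (f := fun g => act g @^-1` A) cptN.
  have [_ [[g _ <-] Ag]] := closure_meet_open (mN x Nx a Na) oA Aa.
  by exists g; apply: (@continuous_act g x A); exact: open_nbhs_nbhs.
by exists F.
Qed.

End FlowBasics.

(** * Subflows, homomorphisms and factors *)
Section Subflow.
Context (G : topologicalGroupType) (X : flow G) (N : set X).
Hypotheses (cN : closed N) (iN : act_invariant N).

Definition subflow_act (g : G) (x : set_type N) : set_type N :=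
  exist (fun y => y \in N) (act g (set_val x)) (mem_set (iN g (set_valP x))).

Let subact1 x : subflow_act 1 x = x.
Proof. by apply: val_inj; exact: act1. Qed.

Let subactM g h x : subflow_act (g * h) x = subflow_act g (subflow_act h x).
Proof. by apply: val_inj; exact: actM. Qed.

Let subact_continuous :
  continuous (fun p : G * set_type N => subflow_act p.1 p.2).
Proof.
apply: continuous_comp_initial => -[g x] A /= /act_nbhs [V nV [B nB VB]].
exists (V, set_val @^-1` B) => /=.
  by split=> //; exact: initial_continuous.
by move=> [h y] [/= Vh By]; exact: VB.
Qed.

Let subflow_compact : compact [set: set_type N].
Proof.
by apply: set_type_compact; apply: subclosed_compact (@flow_compact _ X) _.
Qed.

Let subflow_T3 : T3_space (set_type N).
Proof.
apply: compact_T3 => //; apply: set_type_hausdorff.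
by have [] := @flow_T3 _ X.
Qed.

Definition subflow : flow G :=
  Flow subact1 subactM subact_continuous subflow_compact subflow_T3.

Definition subflow_val (x : subflow) : X := set_val x.

Lemma subflow_valP x : N (subflow_val x).
Proof. exact: set_valP. Qed.

Lemma subflow_val_onto x : N x -> exists y, subflow_val y = x.
Proof. by move=> Nx; exists (exist (fun y => y \in N) x (mem_set Nx)). Qed.

Lemma subflow_val_act g x : subflow_val (act g x) = act g (subflow_val x).
Proof. by []. Qed.

Lemma continuous_subflow_val : continuous subflow_val.
Proof. exact: initial_continuous. Qed.

Lemma subflow_nbhs (x : subflow) (A : set subflow) : nbhs x A <->
  exists2 B, nbhs (subflow_val x) B & forall y, B (subflow_val y) -> A y.
Proof. exact: set_type_nbhs. Qed.

Lemma subflow_open (A : set subflow) : open A <->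
  exists2 B, open B & A = subflow_val @^-1` B.
Proof. exact: set_type_open. Qed.

Lemma minimal_subflow : minimal_set N -> minimal_flow subflow.
Proof.
move=> [_ [n Nn] _ mN]; split; first by have [y _] := subflow_val_onto Nn; exists y.
move=> x A [y Oy] /subflow_open [O oO AO]; rewrite AO in Oy *.
have [_ [[g _ <-] Og]] :=
  closure_meet_open (mN _ (subflow_valP x) _ (subflow_valP y)) oO Oy.
by exists (act g x); split=> //; exists g.
Qed.

End Subflow.

Arguments subflow_val {G X N cN iN} x.

Record cts_hom (K G : topologicalGroupType) := CtsHom {
  hom_fun :> K -> G;
  hom1 : hom_fun 1 = 1;
  homM : forall k l, hom_fun (k * l) = hom_fun k * hom_fun l;
  hom_continuous : continuous hom_fun
}.

Lemma homV (K G : topologicalGroupType) (phi : cts_hom K G) k :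
  phi k^-1 = (phi k)^-1.
Proof. by apply: (@mulgI _ (phi k)); rewrite -homM !mulgV hom1. Qed.

Definition id_hom (G : topologicalGroupType) : cts_hom G G :=
  @CtsHom G G id erefl (fun _ _ => erefl) (fun x => @cvg_id _ (nbhs x)).

Definition incl_hom (G : topologicalGroupType) (H : subgroup G) :
    cts_hom (subgroup_type H) G :=
  @CtsHom (subgroup_type H) G (@subgroup_val G H) erefl (fun _ _ => erefl)
    (@subgroup_val_continuous G H).

(** When [K] is Hausdorff, this says that [phi] is a topological embedding. *)
Definition embedding_hom (K G : topologicalGroupType) (phi : cts_hom K G) :=
  forall W, nbhs 1 W -> exists2 W', nbhs 1 W' & forall k, W' (phi k) -> W k.

Lemma id_hom_embedding (G : topologicalGroupType) : embedding_hom (id_hom G).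
Proof. by move=> W nW; exists W. Qed.

Lemma incl_hom_embedding (G : topologicalGroupType) (H : subgroup G) :
  embedding_hom (incl_hom H).
Proof. by move=> W /set_type_nbhs [B nB BW]; exists B => // k Bk; apply: BW. Qed.

Lemma symmetric_open_preimage (K G : topologicalGroupType) (phi : cts_hom K G) U :
  symmetric_open_nbhs1 U -> symmetric_open_nbhs1 (phi @^-1` U).
Proof.
move=> [oU U1 sU]; split; last by move=> k /= /sU; rewrite homV.
  by apply: open_comp => // x _; exact: hom_continuous.
by rewrite /= hom1.
Qed.

Section Pullback.
Context (K G : topologicalGroupType) (phi : cts_hom K G) (X : flow G).

Let pact1 x : act (phi 1) x = x :> X.
Proof. by rewrite hom1 act1. Qed.

Let pactM k l x : act (phi (k * l)) x = act (phi k) (act (phi l) x) :> X.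
Proof. by rewrite homM actM. Qed.

Let pact_continuous : continuous (fun p : K * X => act (phi p.1) p.2).
Proof.
move=> [k x] A /= /act_nbhs [V nV [B nB VB]].
exists (phi @^-1` V, B) => /=; first by split=> //; exact: hom_continuous.
by move=> [h y] [/= Vh By]; exact: VB.
Qed.

Definition pullback_flow : flow K :=
  @Flow K X (fun k x => act (phi k) x) pact1 pactM pact_continuous
    (@flow_compact _ X) (@flow_T3 _ X).

End Pullback.

Section Factors.
Context (G : topologicalGroupType) (X Y : flow G) (f : X -> Y).
Hypotheses (cf : continuous f) (ef : equivariant f).

Lemma image_act_set U A : f @` (act_set U A) = act_set U (f @` A).
Proof.
apply/seteqP; split.
  by move=> _ [_ [g Ug [x Ax <-]] <-]; exists g => //; exists (f x) => //; exists x.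
by move=> _ [g Ug [_ [x Ax <-] <-]]; exists (act g x) => //; exists g => //; exists x.
Qed.

Lemma image_closure A : f @` closure A `<=` closure (f @` A).
Proof.
move=> _ [x clx <-] B nB; have [y [Ay By]] := clx _ (cf nB).
by exists (f y); split=> //; exists y.
Qed.

Lemma equivariant_onto : [set: X] !=set0 -> minimal_flow Y -> range f = [set: Y].
Proof.
move=> [x _] [_ dY]; apply/seteqP; split=> // y _.
have hY : hausdorff_space Y by have [] := @flow_T3 _ Y.
suff : closure (range f) y.
  apply: compact_closed hY _ _; apply: continuous_compact (@flow_compact _ X).
  by apply: continuous_subspaceT.
move=> B nB; have [||z [Bz [g _ gz]]] := dY (f x) (interior B).
- by exists y.
- exact: open_interior.
exists z; split; last exact: interior_subset.
by exists (act g x) => //; rewrite ef.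
Qed.

(** A TT set [B] upstairs inside the preimage of [A] is pushed down to the
    interior of the closure of its image.  This interior is nonempty since
    finitely many translates of [B] cover, and it meets [A] because the image of
    [B] lies in [A]. *)
Lemma densely_TT_factor : minimal_flow X -> range f = [set: Y] ->
  densely_TT X -> densely_TT Y.
Proof.
move=> mX fY tX U sU A oA [a Aa].
have [x _ fx] : range f a by rewrite fY.
have [||B BA [oB B0 BTT]] := tX U sU (f @^-1` A).
- by apply: open_comp.
- by exists x; rewrite /= fx.
have Y0 : [set: Y] !=set0 by exists a.
have mX' := (minimal_set_setT X).1 mX.
have [|F fF FB] := minimal_set_cover mX' oB; first by rewrite setTI.
have [y Iy] : interior (closure (f @` B)) !=set0.
  apply: (interior_closure_translate (F := [set g^-1 | g in F])) => //.
    exact: finite_image.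
  move=> y; have [z _ <-] : range f y by rewrite fY.
  apply: subset_closure; have [g Fg Bg] := FB z I.
  exists g^-1; first by exists g.
  by exists (act g (f z)); [exists (act g z) => //; rewrite ef|rewrite actK].
exists (interior (closure (f @` B)) `&` A); first by move=> ? [].
have oI : open (interior (closure (f @` B))) by exact: open_interior.
split; [exact: openI| |].
  have [z [[b Bb <-] Ib]] := closure_meet_open (interior_subset Iy) oI Iy.
  by exists (f b); split=> //; exact: BA.
move=> E oE [e Ee] EI.
have [/interior_subset ecl Ae] := EI _ Ee.
have [_ [[b Bb <-] Eb]] := closure_meet_open ecl oE Ee.
apply: subset_trans (@subIsetl _ _ _) _.
apply: subset_trans (@interior_subset _ _) _.
apply: closure_sub; first exact: closed_closure.
move=> _ [c Bc <-].
have h : closure (act_set U (B `&` f @^-1` E)) c.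
  apply: BTT Bc => [|| ? []//]; last by exists b.
  by apply: openI => //; apply: open_comp.
have {}h : (f @` closure (act_set U (B `&` f @^-1` E))) (f c) by exists c.
move/image_closure: h; rewrite image_act_set; apply: closureS.
by apply: act_setS => // _ [z [_ Ez] <-].
Qed.

Lemma G_finite_factor : range f = [set: Y] -> G_finite X -> G_finite Y.
Proof.
move=> fY fX U sU F Fo tF.
have inj A B : f @^-1` A = f @^-1` B -> A = B.
  move=> AB; apply/seteqP; split=> y; have [z _ <-] : range f y by rewrite fY.
    by rewrite -[A (f z)]/((f @^-1` A) z) AB.
  by rewrite -[B (f z)]/((f @^-1` B) z) -AB.
have : finite_set [set f @^-1` A | A in F].
  apply: (fX U) => //.
    move=> _ [A /Fo [oA [a Aa]] <-]; split; first by apply: open_comp.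
    have [z _ za] : range f a by rewrite fY.
    by exists z; rewrite /= za.
  move=> _ _ [A FA <-] [B FB <-] [_ [[g Ug [x Ax <-]] [h Uh [y By hg]]]].
  rewrite (tF A B) //; exists (act g (f x)); split.
    by exists g => //; exists (f x).
  by exists h => //; exists (f y) => //; rewrite -ef hg ef.
move=> fin; apply: sub_finite_set (finite_image (fun B => f @` B) fin).
move=> A FA; exists (f @^-1` A); first by exists A.
by apply: image_preimage.
Qed.

End Factors.

Lemma TMD_minimal (G : topologicalGroupType) (X : flow G) :
  TMD G -> minimal_flow X -> densely_TT X.
Proof.
move=> [M [mM uM] tM] mX; have [f [cf ef fX]] := uM X mX.
exact: densely_TT_factor fX tM.
Qed.

Lemma CMD_minimal (G : topologicalGroupType) (X : flow G) :
  CMD G -> minimal_flow X -> G_finite X.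
Proof.
move=> [M [mM uM] tM] mX; have [f [cf ef fX]] := uM X mX.
exact: G_finite_factor fX tM.
Qed.

(** * The Samuel compactification *)

(** The proximity of the uniformity with entourages y x^-1 \in V, in its
    strong-inclusion form: [B] is far from the complement of [A]. *)
Definition thickens (G : topologicalGroupType) (B A : set G) :=
  exists2 V, symmetric_open_nbhs1 V & forall v b, V v -> B b -> A (v * b).

(** The ends of that proximity: round filters (each member contains a
    thickening of another one) that decide every pair [B], [A] with [B] strongly
    included in [A].  The last condition expresses maximality; it replaces the
    choice of an ultrafilter inducing the end, and it is what survives limits. *)
Record samuel (G : topologicalGroupType) := Samuel {
  samuel_filter :> set G -> Prop;
  samuel_proper : ProperFilter samuel_filter;
  samuel_round : forall A, samuel_filter A ->
    exists2 B, samuel_filter B & thickens B A;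
  samuel_prime : forall A B, thickens B A ->
    samuel_filter A \/ samuel_filter (~` B)
}.

Section Thickens.
Context (G : topologicalGroupType).
Implicit Types (A B C : set G) (U V W : set G).

Lemma thickensW U B A : nbhs 1 U -> (forall v b, U v -> B b -> A (v * b)) ->
  thickens B A.
Proof.
by move=> /nbhs1_sym [V sV VU] UBA; exists V => // v b /VU Uv Bb; exact: UBA.
Qed.

Lemma thickens_sub A B : thickens B A -> B `<=` A.
Proof. by move=> [V [_ V1 _] VBA] b Bb; rewrite -(mul1g b); exact: VBA. Qed.

Lemma thickens_interpolate B A : thickens B A ->
  exists2 C, thickens B C & thickens C A.
Proof.
move=> [V sV VBA]; have [W sW WV] := nbhs1_mul (symmetric_open_nbhs sV).
exists (mul_set W B).
  by exists W => // v b Wv Bb; exists v => //; exists b.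
exists W => // v _ Wv [w Ww [b Bb <-]]; rewrite mulgA.
by apply: VBA => //; exact: WV.
Qed.

Lemma thickensC B A : thickens B A -> thickens (~` A) (~` B).
Proof.
move=> [V sV VBA]; exists V => // v a Vv nA Bva; apply: nA.
by rewrite -(mulKg v a); apply: VBA => //; case: sV => _ _; apply.
Qed.

Lemma thickensI B A B' A' : thickens B A -> thickens B' A' ->
  thickens (B `&` B') (A `&` A').
Proof.
move=> [V sV VBA] [V' sV' VBA']; exists (V `&` V').
  exact: symmetric_open_nbhs1I.
by move=> v b [? ?] [? ?]; split; [exact: VBA|exact: VBA'].
Qed.

Lemma thickensS B A A' : A `<=` A' -> thickens B A -> thickens B A'.
Proof. by move=> AA' [V sV VBA]; exists V => // v b ? ?; apply/AA'/VBA. Qed.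

End Thickens.

#[global] Existing Instance samuel_proper.

Section SamuelTopology.
Context (G : topologicalGroupType).
Implicit Types (A B C : set G) (p q : samuel G).

HB.instance Definition _ := gen_eqMixin (samuel G).
HB.instance Definition _ := gen_choiceMixin (samuel G).

(** Inclusion is enough, as these filters are maximal among round filters. *)
Lemma samuelP p q : (forall A, p A -> q A) -> p = q.
Proof.
move=> pq.
have E : samuel_filter p = samuel_filter q.
  apply/seteqP; split=> // A /samuel_round [B qB BA].
  have [//|/pq nB] := samuel_prime p BA.
  by have [x []] := filter_ex (filterI qB nB).
case: p q E {pq} => [p p1 p2 p3] [q q1 q2 q3] /= E; subst q.
by congr Samuel; exact: Prop_irrelevance.
Qed.

Definition samuel_base A : set (samuel G) := [set p | samuel_filter p A].

Let base_cover : \bigcup_(A in [set: set G]) samuel_base A = setT.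
Proof. by apply/seteqP; split=> // p _; exists setT => //; exact: filterT. Qed.

Let base_join A B p : [set: set G] A -> [set: set G] B ->
  samuel_base A p -> samuel_base B p -> exists C, [/\ [set: set G] C,
    samuel_base C p & samuel_base C `<=` samuel_base A `&` samuel_base B].
Proof.
move=> _ _ pA pB; exists (A `&` B); split=> //; first exact: filterI.
by move=> q qAB; split; apply: filterS qAB => x [].
Qed.

HB.instance Definition _ := isBaseTopological.Build (samuel G)
  base_cover base_join.

Lemma samuel_nbhs p (O : set (samuel G)) :
  nbhs p O <-> exists2 A, p A & samuel_base A `<=` O.
Proof.
split=> [[P [[D _ <-] [A DA pA] DO]]|[A pA AO]].
  by exists A => // q qA; apply: DO; exists A.
exists (samuel_base A); split=> //; exists [set A]; first by [].
exact: bigcup_set1.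
Qed.

Lemma samuel_base_nbhs p A : p A -> nbhs p (samuel_base A).
Proof. by move=> pA; apply/samuel_nbhs; exists A. Qed.

Lemma samuel_hausdorff : hausdorff_space (samuel G).
Proof.
move=> p q pq; apply: samuelP => A /samuel_round [B pB BA].
have [//|qB] := samuel_prime q BA.
have [r [rB rnB]] := pq _ _ (samuel_base_nbhs pB) (samuel_base_nbhs qB).
by have [x []] := filter_ex (filterI rB rnB).
Qed.

(** The limit of an ultrafilter on the space of ends is the set of thickenings
    of sets that almost all ends contain. *)
Section Limit.
Context (F : set_system (samuel G)) (FU : UltraFilter F).

Let lim A := exists2 B, F (samuel_base B) & thickens B A.

Let lim_proper : ProperFilter lim.
Proof.
apply: Build_ProperFilter_ex.
  move=> A [B /filter_ex [p pB] BA].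
  by have [x /(thickens_sub BA)] := filter_ex pB; exists x.
split.
- exists setT; last by exists setT => //; split=> //; exact: openT.
  by apply: (@filterS _ F _ setT) => [p _|]; exact: filterT.
- move=> A A' [B FB BA] [B' FB' BA']; exists (B `&` B'); last exact: thickensI.
  by apply: filterS (filterI FB FB') => p [pB pB']; exact: filterI.
- by move=> A A' AA' [B FB BA]; exists B => //; exact: thickensS BA.
Qed.

Let lim_round A : lim A -> exists2 B, lim B & thickens B A.
Proof.
move=> [B FB /thickens_interpolate [C BC CA]].
by exists C => //; exists B.
Qed.

Let lim_prime A B : thickens B A -> lim A \/ lim (~` B).
Proof.
move=> /thickens_interpolate [C BC /thickens_interpolate [D CD DA]].
have [FD|FnD] := in_ultra_setVsetC (samuel_base D) FU; [left|right].
  by exists D.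
exists (~` C); last exact: thickensC.
by apply: filterS FnD => p npD; have [] := samuel_prime p CD.
Qed.

Lemma samuel_ultra_cvg : exists p : samuel G, F --> p.
Proof.
exists (Samuel lim_proper lim_round lim_prime) => O /samuel_nbhs [A [B FB BA] AO].
by apply: filterS FB => p pB; apply: AO; apply: filterS pB; exact: thickens_sub.
Qed.

End Limit.

Lemma samuel_compact : compact [set: samuel G].
Proof.
rewrite compact_ultra => F FU _; have [p Fp] := samuel_ultra_cvg FU.
by exists p.
Qed.

Let point_round (g : G) A : nbhs g A -> exists2 B, nbhs g B & thickens B A.
Proof.
rewrite -{1}(mul1g g) => /mulg_nbhs [V nV [W nW VW]].
by exists W => //; exact: thickensW nV VW.
Qed.

Let point_prime (g : G) A B : thickens B A -> nbhs g A \/ nbhs g (~` B).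
Proof.
move=> [V [oV V1 sV] VBA].
have nV : nbhs g [set x | V (x * g^-1)].
  have := nbhs_mulgr g^-1 (open_nbhs_nbhs (conj oV V1)).
  by rewrite invgK mul1g.
have [[v [Vv Bvg]]|nB] := pselect (exists v, V v /\ B (v * g)); [left|right].
  have nV' := nbhs_mulgr (v * g)^-1 (open_nbhs_nbhs (conj oV (sV _ Vv))).
  rewrite invgK mulKg in nV'; apply: filterS nV' => x /= Vx.
  by rewrite -(mulgVK (v * g) x); exact: VBA.
apply: filterS nV => x /= Vx Bx; apply: nB; exists (x * g^-1).
by split=> //; rewrite mulgVK.
Qed.

Definition samuel_point (g : G) : samuel G :=
  Samuel (nbhs_pfilter g) (@point_round g) (@point_prime g).

Let act_filter (g : G) p A := p [set x | A (g * x)].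

Let act_proper g p : ProperFilter (act_filter g p).
Proof. exact: (@fmap_proper_filter _ _ (fun x => g * x) p). Qed.

Lemma thickens_mull g B A : thickens B A ->
  thickens [set x | B (g * x)] [set x | A (g * x)].
Proof.
move=> [V sV VBA]; exists [set v | V (g * v * g^-1)].
  exact: symmetric_open_conj.
move=> v b /= Vv Bgb; have := VBA _ _ Vv Bgb.
by rewrite -!mulgA mulKg.
Qed.

Let act_round g p A : act_filter g p A ->
  exists2 B, act_filter g p B & thickens B A.
Proof.
move=> /samuel_round [B pB BA]; exists [set x | B (g^-1 * x)].
  by apply: filterS pB => x Bx /=; rewrite mulKg.
have := thickens_mull g^-1 BA; apply: thickensS => x /=; rewrite mulVKg.
exact.
Qed.

Let act_prime g p A B : thickens B A ->
  act_filter g p A \/ act_filter g p (~` B).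
Proof. by move=> BA; exact: (samuel_prime p (thickens_mull g BA)). Qed.

Definition samuel_act (g : G) p : samuel G :=
  Samuel (act_proper g p) (@act_round g p) (@act_prime g p).

Let sact1 p : samuel_act 1 p = p.
Proof.
apply: samuelP => A; apply: (@filterS _ p _ [set x | A (1 * x)]) => x /=.
by rewrite mul1g.
Qed.

Let sactM g h p : samuel_act (g * h) p = samuel_act g (samuel_act h p).
Proof.
apply: samuelP => A.
apply: (@filterS _ p _ [set x | A (g * h * x)] [set x | A (g * (h * x))]) => x /=.
by rewrite mulgA.
Qed.

Let sact_continuous : continuous (fun x : G * samuel G => samuel_act x.1 x.2).
Proof.
move=> [g p] O /= /samuel_nbhs [A pA AO].
have [B pB [V [oV V1 sV] VBA]] := samuel_round pA.
exists ([set h | V (h * g^-1)], samuel_base [set x | B (g * x)]) => /=.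
  split; last exact: samuel_base_nbhs.
  have := nbhs_mulgr g^-1 (open_nbhs_nbhs (conj oV V1)).
  by rewrite invgK mul1g.
move=> [h q] [/= Vh qB]; apply: AO.
apply: (@filterS _ q _ [set x | B (g * x)]) => // x Bgx /=.
by rewrite -(mulgVK g h) -mulgA; exact: VBA.
Qed.

Definition samuel_flow : flow G :=
  @Flow G (samuel G) samuel_act sact1 sactM sact_continuous samuel_compact
    (compact_T3 samuel_hausdorff samuel_compact).

Lemma samuel_act_point g h :
  act g (samuel_point h : samuel_flow) = samuel_point (g * h).
Proof.
apply: samuelP => A /= nA; have := nbhs_mulgl g^-1 nA; rewrite invgK.
by apply: filterS => x /=; rewrite mulVKg.
Qed.

Lemma samuel_points_dense p : closure (range samuel_point) p.
Proof.
move=> O /samuel_nbhs [A /samuel_round [B /filter_ex [b Bb]]].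
move=> [V [oV V1 sV] VBA] AO; exists (samuel_point b); split; first by exists b.
apply: AO; have := nbhs_mulgr b^-1 (open_nbhs_nbhs (conj oV V1)).
rewrite invgK mul1g; apply: filterS => x /= Vx.
by rewrite -(mulgVK b x); exact: VBA.
Qed.

(** The universal property in its combinatorial form: uniformly separated
    subsets of [G] have disjoint closures. *)
Lemma samuel_separate (W S T : set G) p : nbhs 1 W ->
  (forall w s, W w -> S s -> T (w * s) -> False) ->
  closure (samuel_point @` S) p -> closure (samuel_point @` T) p -> False.
Proof.
move=> nW WST clS clT.
have : thickens S (~` T) by apply: thickensW nW _ => w s Ww Ss; exact: WST Ww Ss.
move=> /(samuel_prime p) [pT|pS].
  have [_ [[t Tt <-] /nbhs_singleton]] := clT _ (samuel_base_nbhs pT).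
  by apply.
have [_ [[s Ss <-] /nbhs_singleton]] := clS _ (samuel_base_nbhs pS).
by apply.
Qed.

End SamuelTopology.

Arguments samuel_point {G} g.

(** * Extending orbit maps and universality *)

(** A map [f] into a compact space, indexed by points [phi k] of [G], extends
    continuously to the closure of these points as soon as the preimages of
    suitable neighbourhoods of distinct points are uniformly separated in [G].
    The extension is described by its graph [samuel_lim], a form in which
    equivariance is immediate. *)
Section Extension.
Context (K : Type) (G : topologicalGroupType) (phi : K -> G).
Context (Y : topologicalType) (f : K -> Y).
Hypotheses (cY : compact [set: Y]).
Hypothesis f_separate : forall y1 y2 : Y, y1 <> y2 ->
  exists2 A, nbhs y1 A & exists2 B, nbhs y2 B & exists2 W : set G, nbhs 1 W &
  forall k l, W (phi l * (phi k)^-1) -> A (f k) -> B (f l) -> False.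
Implicit Types (p q : samuel G) (y : Y).

Definition samuel_lim p y := forall O R, nbhs p O -> nbhs y R ->
  exists2 k, O (samuel_point (phi k)) & R (f k).

Lemma samuel_lim_unique p y1 y2 :
  samuel_lim p y1 -> samuel_lim p y2 -> y1 = y2.
Proof.
move=> py1 py2; apply: contrapT => /f_separate [A nA [B nB [W nW AB]]].
apply: (@samuel_separate G W (phi @` (f @^-1` A)) (phi @` (f @^-1` B)) p) => //.
- move=> w _ Ww [k Ak <-] [l Bl wkl]; apply: (AB k l) => //.
  by rewrite wkl mulgK.
- move=> O nO; have [k Ok Ak] := py1 _ _ nO nA; exists (samuel_point (phi k)).
  by split=> //; exists (phi k) => //; exists k.
- move=> O nO; have [k Ok Bk] := py2 _ _ nO nB; exists (samuel_point (phi k)).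
  by split=> //; exists (phi k) => //; exists k.
Qed.

Lemma samuel_lim_exists p : closure (range (samuel_point \o phi)) p ->
  exists y, samuel_lim p y.
Proof.
move=> clp.
pose F := filter_from (nbhs p) (fun O => f @` [set k | O (samuel_point (phi k))]).
have FF : ProperFilter F.
  apply: filter_from_proper; last first.
    by move=> O /clp [_ [[k _ <-] Ok]]; exists (f k), k.
  apply: filter_from_filter; first by exists setT; exact: filterT.
  move=> O O' nO nO'; exists (O `&` O'); first exact: filterI.
  by move=> _ [k [? ?] <-]; split; exists k.
have [|y [_ clFy]] := cY FF; first exact: filterT.
exists y => O R nO nR.
have [|_ [[k Ok <-] Rk]] :=
  clFy (f @` [set k | O (samuel_point (phi k))]) R _ nR; first by exists O.
by exists k.
Qed.

Lemma samuel_lim_continuous p y R : samuel_lim p y -> nbhs y R ->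
  exists2 O, nbhs p O & forall q z, O q -> samuel_lim q z -> R z.
Proof.
move=> py nR; apply: contrapT => nO.
(* If continuity failed, the values of the extension near [p] would cluster
   outside the interior of [R]; a cluster point would be a second limit. *)
pose bad O := [set z | ~ interior R z /\ exists2 q, O q & samuel_lim q z].
have FF : ProperFilter (filter_from (nbhs p) bad).
  apply: filter_from_proper; last first.
    move=> O npO; apply: contrapT => bad0; apply: nO; exists O => // q z Oq qz.
    apply: contrapT => nRz; apply: bad0; exists z; split; last by exists q.
    by move=> /interior_subset.
  apply: filter_from_filter; first by exists setT; exact: filterT.
  move=> O O' npO npO'; exists (O `&` O'); first exact: filterI.
  by move=> z [nRz [q [? ?] qz]]; split; split=> //; exists q.
have [|z [_ clz]] := cY FF; first exact: filterT.
have yz : y <> z.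
  move=> yz; have [||w [[nRw _] Rw]] := clz (bad setT) (interior R).
  - by exists setT => //; exact: filterT.
  - by rewrite -yz; exact: nbhs_interior.
  - exact: nRw.
apply: yz; apply: samuel_lim_unique py _ => O Q npO nzQ.
have [||w [[_ [q Oq qw]] Qw]] := clz (bad (interior O)) (interior Q).
- by exists (interior O) => //; exact: nbhs_interior.
- exact: nbhs_interior.
have [k Ok Qk] := qw _ _ (open_nbhs_nbhs (conj (open_interior O) Oq))
  (open_nbhs_nbhs (conj (open_interior Q) Qw)).
by exists k; exact: interior_subset.
Qed.

End Extension.

Section Universality.
Context (K G : topologicalGroupType) (phi : cts_hom K G).
Hypothesis phi_emb : embedding_hom phi.

Definition hom_closure : set (samuel_flow G) :=
  closure (range (samuel_point \o phi)).

Lemma hom_closure_invariant k p : hom_closure p -> hom_closure (act (phi k) p).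
Proof.
move=> clp O nO.
have [_ [[l _ <-] Ol]] := clp _ (@continuous_act _ _ (phi k) p _ nO).
exists (samuel_point (phi (k * l))); split; first by exists (k * l).
by rewrite homM -samuel_act_point.
Qed.

Section Orbit.
Context (Z : flow K) (z : Z).

Let f k := act k z.

(** If [f k] is in a small neighbourhood of [y1] and [l k^-1] is close to 1,
    then [f l] is still near [y1]; closeness may be tested in [G] since [phi] is
    an embedding. *)
Lemma orbit_map_separate (y1 y2 : Z) : y1 <> y2 ->
  exists2 A, nbhs y1 A & exists2 B, nbhs y2 B & exists2 W : set G, nbhs 1 W &
  forall k l, W (phi l * (phi k)^-1) -> A (f k) -> B (f l) -> False.
Proof.
have hZ : hausdorff_space Z by have [] := @flow_T3 _ Z.
move=> /(hausdorff_separate hZ) [A nA [B nB AB]].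
rewrite -(act1 y1) in nA; have [V nV [R nR VR]] := act_nbhs nA.
have [W nW WV] := phi_emb nV.
exists R => //; exists B => //; exists W => // k l Wkl Rk Bl.
apply: AB (Bl); have -> : f l = act (l * k^-1) (f k) by rewrite /f actM actK.
by apply: VR Rk; apply: WV; rewrite homM homV.
Qed.

Let lim := samuel_lim phi f.

Lemma orbit_lim_act k p y : lim p y -> lim (act (phi k) (p : samuel_flow G)) (act k y).
Proof.
move=> py O R nO nR.
have [l Ol Rl] := py _ _ (@continuous_act _ (samuel_flow G) (phi k) p _ nO)
  (@continuous_act _ _ k y _ nR).
exists (k * l); last by rewrite /f actM.
by rewrite homM -samuel_act_point.
Qed.

Lemma samuel_orbit_map (N : flow K) (i : N -> samuel_flow G) :
    continuous i -> (forall k n, i (act k n) = act (phi k) (i n)) ->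
    (forall n, hom_closure (i n)) ->
  exists h : N -> Z, [/\ continuous h, equivariant h &
    forall n, i n = samuel_point 1 -> h n = z].
Proof.
move=> ci ei Ni.
have cZ := @flow_compact _ Z.
have /choice [h hP] n : exists y, lim (i n) y by exact: samuel_lim_exists (Ni n).
exists h; split.
- move=> n R nR.
  have [O nO OR] := samuel_lim_continuous cZ orbit_map_separate (hP n) nR.
  have niO : nbhs n (i @^-1` O) by exact: ci.
  by apply: filterS niO => m Om; exact: OR Om (hP m).
- move=> k n; have := @orbit_lim_act k _ _ (hP n); rewrite -ei.
  exact: (samuel_lim_unique orbit_map_separate (hP (act k n))).
- move=> n in1.
  have : lim (i n) z.
    rewrite in1 => O R nO nR; exists 1; first by rewrite hom1; exact: nbhs_singleton.
    by rewrite /f act1; exact: nbhs_singleton.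
  exact: (samuel_lim_unique orbit_map_separate (hP n)).
Qed.

End Orbit.

(** Stated for a map [i] rather than for a subset of S(G): the flow of interest
    for a subgroup is obtained in two steps, as an H-minimal subset of a minimal
    subflow of S(G). *)
Lemma samuel_universal_minimal (N : flow K) (i : N -> samuel_flow G) :
    continuous i -> (forall k n, i (act k n) = act (phi k) (i n)) ->
    (forall n, hom_closure (i n)) ->
  minimal_flow N -> universal_minimal_flow N.
Proof.
move=> ci ei Ni mN; split=> // Z mZ; have [[z _] _] := mZ.
have [h [ch eh _]] := samuel_orbit_map z ci ei Ni.
by exists h; split=> //; apply: equivariant_onto => //; case: mN.
Qed.

End Universality.

Lemma hom_closure_id (G : topologicalGroupType) p : hom_closure (id_hom G) p.
Proof. exact: samuel_points_dense. Qed.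

Lemma exists_minimal_flow (G : topologicalGroupType) (X : flow G) :
  [set: X] !=set0 -> exists N, @minimal_set G X N.
Proof.
move=> X0.
have [N mN _] := @exists_minimal_set G X setT closedT X0 (fun _ _ _ => I).
by exists N.
Qed.

Lemma samuel_nonempty (G : topologicalGroupType) : [set: samuel_flow G] !=set0.
Proof. by exists (samuel_point 1). Qed.

Lemma exists_universal_minimal_flow (G : topologicalGroupType) :
  exists M : flow G, universal_minimal_flow M.
Proof.
have [N mN] := exists_minimal_flow (samuel_nonempty G).
have [cN _ iN _] := mN; exists (subflow cN iN).
apply: (samuel_universal_minimal (@id_hom_embedding G) (i := @subflow_val _ _ _ cN iN)).
- exact: continuous_subflow_val.
- by [].
- by move=> n; exact: hom_closure_id.
- exact: minimal_subflow.
Qed.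

(** Existence of M(G) matters for the converse: TMD asserts that some universal
    minimal flow is densely TT. *)
Lemma TMD_iff_minimal (G : topologicalGroupType) :
  TMD G <-> forall X : flow G, minimal_flow X -> densely_TT X.
Proof.
split=> [tG X|tX]; first exact: TMD_minimal.
have [M uM] := exists_universal_minimal_flow G; exists M => //.
by apply: tX; case: uM.
Qed.

Lemma CMD_iff_minimal (G : topologicalGroupType) :
  CMD G <-> forall X : flow G, minimal_flow X -> G_finite X.
Proof.
split=> [tG X|tX]; first exact: CMD_minimal.
have [M uM] := exists_universal_minimal_flow G; exists M => //.
by apply: tX; case: uM.
Qed.

(** * Idempotents and retractions onto minimal sets *)
Section Ellis.
Context (G : topologicalGroupType).
Local Notation S := (samuel_flow G).
Implicit Types p q : S.

Let hS : hausdorff_space S := @samuel_hausdorff G.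
Let cS : compact [set: S] := @samuel_compact G.

Lemma exists_rmul q : exists h : S -> S,
  [/\ continuous h, equivariant h & h (samuel_point 1) = q].
Proof.
have [|||h [ch eh h1]] :=
  @samuel_orbit_map _ _ _ (@id_hom_embedding G) S q S id.
- by move=> x; exact: cvg_id.
- by [].
- exact: hom_closure_id.
- by exists h; split=> //; exact: h1.
Qed.

(** The product of the semigroup S(G): [rmul q p] is p q, the extension of the
    orbit map of [q] evaluated at [p].  It is continuous in [p] for fixed [q]. *)
Definition rmul q : S -> S := projT1 (cid (exists_rmul q)).

Lemma rmul_continuous q : continuous (rmul q).
Proof. by have [] := projT2 (cid (exists_rmul q)). Qed.

Lemma rmul_act q g p : rmul q (act g p) = act g (rmul q p).
Proof. by have [_ eh _] := projT2 (cid (exists_rmul q)); exact: eh. Qed.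

Lemma rmul1 q : rmul q (samuel_point 1) = q.
Proof. by have [] := projT2 (cid (exists_rmul q)). Qed.

Lemma rmul_point q g : rmul q (samuel_point g) = act g q.
Proof. by rewrite -{1}(mulg1 g) -samuel_act_point rmul_act rmul1. Qed.

Lemma rmul_comp p q r : rmul p (rmul q r) = rmul (rmul p q) r.
Proof.
suff : [set: S] `<=` [set r | (rmul p \o rmul q) r = rmul (rmul p q) r] by exact.
apply: subset_trans (closure_sub (closed_eq_fun hS _ _) _).
- by move=> x _; exact: samuel_points_dense.
- by move=> x; apply: continuous_comp; exact: rmul_continuous.
- exact: rmul_continuous.
- by move=> _ [g _ <-] /=; rewrite !rmul_point rmul_act.
Qed.

Definition subsemigroup (T : set S) := forall p q, T p -> T q -> T (rmul q p).

(** The Ellis-Numakura argument: in a minimal closed subsemigroup [A], both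
    [A p] and the solutions a in [A] of a p = p are closed subsemigroups, hence
    equal to [A]. *)
Lemma exists_idempotent T : closed T -> T !=set0 -> subsemigroup T ->
  exists2 p, T p & rmul p p = p.
Proof.
move=> cT T0 sT.
pose P : set (set S) := [set A | [/\ closed A, A !=set0 & subsemigroup A]].
have [| | |A [[cA [p Ap] sA] AT] Amin] := @chain_minimal S P T cS.
- by [].
- by move=> A [].
- move=> F F0 FP cI I0; split=> // p q Ip Iq A FA.
  by have [_ _] := FP _ FA; apply; [exact: Ip|exact: Iq].
have imA : rmul p @` A = A.
  apply: Amin; last by move=> _ [a Aa <-]; exact: sA.
  split.
  - apply: compact_closed => //; apply: continuous_compact.
      by apply: continuous_subspaceT; exact: rmul_continuous.
    exact: subclosed_compact cA cS _.
  - by exists (rmul p p), p.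
  - move=> x y [a Aa <-] [b Ab <-]; rewrite -rmul_comp.
    by exists (rmul b (rmul p a)) => //; apply: (sA _ _ _ Ab); exact: sA.
have [a Aa pa] : (rmul p @` A) p by rewrite imA.
suff E : A `&` [set a | rmul p a = p] = A.
  by exists p; [exact: AT|have : A p by []; rewrite -{1}E => -[]].
apply: Amin => [|x []//]; split.
- apply: closedI => //; apply: (@closed_eq_fun _ _ (rmul p) (fun=> p)) => //.
    exact: rmul_continuous.
  exact: cst_continuous.
- by exists a.
- move=> x y [Ax px] [Ay py]; split; first exact: sA.
  by rewrite /= rmul_comp py.
Qed.

(** Right multiplication by an idempotent [p] of the minimal set [i N]: this set
    is a left ideal of the closure of the subgroup, so the values are in it, and
    [p] being fixed, its dense orbit in [i N] is fixed as well. *)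
Lemma samuel_retraction (K : topologicalGroupType) (phi : cts_hom K G)
    (N : flow K) (i : N -> S) :
    continuous i -> (forall k n, i (act k n) = act (phi k) (i n)) ->
    (forall n, hom_closure phi (i n)) -> minimal_flow N ->
  exists r : S -> S, [/\ continuous r,
    forall g p, r (act g p) = act g (r p),
    forall p, hom_closure phi p -> range i (r p) & forall n, r (i n) = i n].
Proof.
move=> ci ei Ni [[n0 _] dN].
have cl : closed (range i).
  apply: compact_closed => //; apply: continuous_compact (@flow_compact _ N).
  exact: continuous_subspaceT.
have idl p q : hom_closure phi p -> range i q -> range i (rmul q p).
  move=> clp [n _ <-].
  suff : hom_closure phi `<=` rmul (i n) @^-1` range i by apply.
  apply: closure_sub; first by apply: preimage_closed => // x _; exact: rmul_continuous.
  by move=> _ [k _ <-] /=; rewrite rmul_point -ei; exists (act k n).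
have [|p q [n _ <-] iq|p [n _ np] pp] := exists_idempotent cl.
- by exists (i n0), n0.
- exact: idl.
exists (rmul p); split; [exact: rmul_continuous|exact: rmul_act| |].
  by move=> q clq; apply: idl => //; exists n.
move=> m.
suff : [set: N] `<=` [set m | (rmul p \o i) m = i m] by exact.
apply: subset_trans (closure_sub (A := flow_orbit n) (closed_eq_fun hS _ ci) _).
- move=> x _ O nO; have [||y [Oy [k _ ky]]] := dN n (interior O).
  + by exists x.
  + exact: open_interior.
  exists y; split; last exact: interior_subset.
  by exists k; [exact: I|exact: ky].
- by move=> x; apply: continuous_comp; [exact: ci|exact: rmul_continuous].
- by move=> _ [k _ <-] /=; rewrite ei rmul_act np pp.
Qed.

End Ellis.

(** * Co-precompact subgroups *)
Section Coprecompact.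
Context (G : topologicalGroupType) (H : subgroup G).
Local Notation Ht := (subgroup_type H).
Local Notation phi := (incl_hom H).

Lemma G_finite_coprecompact (X : flow G) : coprecompact (H : set G) ->
  CMD Ht -> minimal_flow X -> G_finite X.
Proof.
move=> cH cmd mX U sU F Fo tF.
have [V [sV VU VV]] := nbhs1_root sU.
have [oV V1 iV] := sV.
have [F0 fF0 F0H] := cH V (symmetric_open_nbhs sV).
have [X0 dX] := mX.
have [N mN] := @exists_minimal_flow _ (pullback_flow phi X) X0.
have [cN [n0 Nn0] iN _] := mN.
have fin : G_finite (subflow cN iN).
  exact: CMD_minimal cmd (minimal_subflow cN iN mN).
(* The trace on [N] of f^-1 V A.  Since G = V F0 H, each member of [F] has a
   nonempty trace for some [f] in [F0]. *)
pose B f A := [set y : subflow cN iN |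
  act_set V A (act f (subflow_val y : X))].
pose Ff f := [set A | F A /\ B f A !=set0].
have FFf : F `<=` \bigcup_(f in F0) Ff f.
  move=> A FA; have [oA A0] := Fo A FA.
  have [x0 [Ax0 [g _ gn]]] := dX n0 A A0 oA.
  have [_ [v Vv [f F0f <-]] [h Hh vfh]] : mul_set (mul_set V F0) H g.
    by rewrite F0H.
  exists f => //; split=> //.
  have [y yh] := subflow_val_onto cN iN (iN (to_subgroup Hh) n0 Nn0).
  exists y; rewrite /B /= yh; exists v^-1; first exact: iV.
  exists (act g n0); first by rewrite gn.
  by rewrite -vfh !actM actK.
have sep f A A' y : F A -> F A' -> B f A y -> B f A' y -> A = A'.
  move=> FA FA' By By'; apply: tF => //; exists (act f (subflow_val y : X)).
  by split; [apply: act_setS By|apply: act_setS By'].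
apply: (sub_finite_set FFf); apply: bigcup_finite => // f F0f.
have finB : finite_set (B f @` Ff f).
(* Translating a trace by h with f h f^-1 in [V] stays in f^-1 V V A, hence in
   f^-1 U A. *)
  have sW := symmetric_open_preimage phi (symmetric_open_conj f sV).
  apply: (fin _ sW).
    move=> _ [A [FA BA] <-]; split=> //; have [oA _] := Fo A FA.
    apply/subflow_open; exists (act f @^-1` act_set V A) => //.
    apply: open_comp; first by move=> x _; exact: continuous_act.
    exact: open_act_set.
  move=> _ _ [A [FA _] <-] [A' [FA' _] <-] [z [zA zA']].
  congr (B f); apply: (tF _ _ FA FA'); exists (act f (subflow_val z : X)).
  have key C : act_set (phi @^-1` [set v | V (f * v * f^-1)]) (B f C) z ->
      act_set U C (act f (subflow_val z : X)).
    move=> [h Vh [y [v Vv [c Cc vc]] <-]]; exists ((f * phi h * f^-1) * v).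
      exact: VV.
    exists c => //; rewrite actM vc -actM mulgVK actM.
    by [].
  by split; exact: key.
pose r E := xget set0 [set A | Ff f A /\ B f A = E].
apply: sub_finite_set (finite_image r finB) => A FfA; exists (B f A).
  by exists A.
rewrite /r; case: xgetP => [A' _ [[FA' _] BA']|]; last by move=> /(_ A) [].
have [FA [y BAy]] := FfA; apply: (sep f _ _ y) => //.
by rewrite BA'.
Qed.

End Coprecompact.

(** * Presyndetic subgroups *)
Section Presyndetic.
Context (G : topologicalGroupType) (H : subgroup G).
Hypothesis pH : presyndetic (H : set G).
Local Notation Ht := (subgroup_type H).
Local Notation phi := (incl_hom H).

Section Minimal.
Context (X : flow G) (mX : minimal_flow X).
Let XH := pullback_flow phi X.
Context (N : set X) (mN : @minimal_set Ht XH N).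

(** Finitely many k in H move any point of [N] into [A].  If [v] is so small
    that every k v k^-1 is in [V], then a point f v h n of the orbit of n is
    carried by f k^-1 from V (N \cap A), and [f] too ranges over a finite set. *)
Lemma presyndetic_interior (V : set G) (A : set X) :
  symmetric_open_nbhs1 V -> open A -> N `&` A !=set0 ->
  interior (closure (act_set V (N `&` A))) !=set0.
Proof.
move=> sV oA NA.
have [K fK KN] := minimal_set_cover mN oA NA.
have [cN [n Nn] iN _] := mN.
pose V' := \bigcap_(k in K) [set v | V (phi k * v * (phi k)^-1)].
have nV' : nbhs 1 V'.
  apply: finite_bigcap_nbhs => // k _; apply: nbhs1_conj.
  exact: symmetric_open_nbhs.
have [F fF FVH] := pH nV'.
pose F' := [set f * (phi k)^-1 | f in F & k in K].
apply: (interior_closure_translate (F := F')).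
- exact: finite_image2.
- by case: mX.
move=> x; have [_ _ _ mX'] := (minimal_set_setT X).1 mX.
apply: closureS (mX' n I x I) => _ [g _ <-].
have [_ [f Ff [v Vv <-]] [h Hh <-]] : mul_set (mul_set F V') H g by rewrite FVH.
have Nhn : N (act h n) by exact: (iN (to_subgroup Hh) n Nn).
have [k Kk Ak] := KN _ Nhn.
exists (f * (phi k)^-1); first by exists f => //; exists k.
exists (act (phi k * v * (phi k)^-1) (act (phi k) (act h n))).
  exists (phi k * v * (phi k)^-1); first exact: Vv.
  exists (act (phi k) (act h n)) => //; split=> //.
  exact: (iN k (act h n) Nhn).
by rewrite -!actM !mulgA !mulgVK.
Qed.

(** If [B] is TT in [N] and [J] is the interior of the closure of V B, then
    V J \cap A is TT in [X]: an open subset of it comes, up to a small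
    translation, back to an open subset of [B], which spreads over [B] by
    translations from H, hence over V J. *)
Lemma presyndetic_densely_TT : TMD Ht -> densely_TT X.
Proof.
move=> tH.
have [cN [n0 Nn0] iN _] := mN.
have tN : densely_TT (subflow cN iN).
  exact: TMD_minimal tH (minimal_subflow cN iN mN).
(* An open set is translated so as to meet [N]; the neighbourhood is conjugated
   accordingly. *)
suff core U A : symmetric_open_nbhs1 U -> open A -> N `&` A !=set0 ->
    exists2 C, C `<=` A & topologically_transitive U C.
  move=> U sU A oA A0.
  have [_ dX] := mX; have [x0 [Ax0 [g _ gn]]] := dX n0 A A0 oA.
  have [||C CA [oC [c Cc] CTT]] :=
      core _ (act g @^-1` A) (symmetric_open_conj g sU).
  - by apply: open_comp => // x _; exact: continuous_act.
  - by exists n0; split=> //; rewrite /= gn.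
  exists (act g^-1 @^-1` C).
    by move=> x /CA /=; rewrite actVK.
  split.
  - by apply: open_comp => // x _; exact: continuous_act.
  - by exists (act g c); rewrite /= actK.
  move=> D oD [d Dd] DC x Cx O nO.
  have [||||y [[w Uw [e De <-]] Oy]] := CTT (act g @^-1` D) _ _ _ _ Cx
      (act g @^-1` O).
  - by apply: open_comp => // z _; exact: continuous_act.
  - by exists (act g^-1 d); rewrite /= actVK.
  - by move=> z /DC /=; rewrite actK.
  - by apply: continuous_act; rewrite actVK.
  exists (act g (act w e)); split=> //; exists (g * w * g^-1) => //.
  by exists (act g e) => //; rewrite -!actM mulgVK.
move=> sU oA [a [Na Aa]].
have [V1 [sV1 V1U V1V1]] := nbhs1_root sU.
have [V2 [sV2 V2V1 V2V2]] := nbhs1_root sV1.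
have [V [sV VV2 VV]] := nbhs1_root sV2.
have [a' a'a] := subflow_val_onto cN iN Na.
have oA' : open ((subflow_val : subflow cN iN -> X) @^-1` A).
  by apply/subflow_open; exists A.
have [|B BA [/subflow_open [B0 oB0 BE] [b Bb] BTT]] :=
    tN _ (symmetric_open_preimage phi sV) _ oA'.
  by exists a'; rewrite /= a'a.
pose B' := N `&` B0.
have B'P x : B' x -> exists2 y : subflow cN iN, B y & subflow_val y = x.
  move=> [Nx B0x]; have [y yx] := subflow_val_onto cN iN Nx.
  by exists y => //; rewrite BE /= yx.
have B'A : B' `<=` A by move=> x /B'P [y /BA Ay <-].
have B'0 : B' !=set0.
  by exists (subflow_val b); split; [exact: subflow_valP|rewrite BE in Bb].
have [i Ii] := presyndetic_interior sV oB0 B'0.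
set J := interior _ in Ii.
have oJ : open J by exact: open_interior.
have JB' : J `<=` closure (act_set V B') by exact: interior_subset.
have VJ : act_set V J `<=` closure (act_set V2 B').
  apply: subset_trans (act_setS (@subset_refl _ V) JB') _.
  apply: subset_trans (@subset_closure _ _) _.
  exact: act_set_closureM.
exists (act_set V J `&` A); first by move=> ? [].
split; first by apply: openI => //; exact: open_act_set.
  have [_ _ iV] := sV.
  have [x [Jx B'x]] := meet_act_set iV (closure_meet_open (JB' _ Ii) oJ Ii).
  by exists x; split=> //; exact: B'A.
move=> D oD [d Dd] DC.
have [VJd _] := DC _ Dd.
have [_ _ iV2] := sV2.
have [e0 [V2De /B'P [e Be ee]]] :=
  meet_act_set iV2 (closure_meet_open (VJ _ VJd) oD Dd).
rewrite -ee in V2De.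
pose E := B `&` (subflow_val : subflow cN iN -> X) @^-1` act_set V2 D.
have oE : open E.
  apply: openI; first by apply/subflow_open; exists B0.
  by apply/subflow_open; exists (act_set V2 D) => //; exact: open_act_set.
have BE' : B' `<=` closure (act_set V1 D).
  move=> _ /B'P [y By <-] O nO.
  have nO' : nbhs y ((subflow_val : subflow cN iN -> X) @^-1` O).
    exact: continuous_subflow_val.
  have [||_ [[h Vh [z [_ V2Dz] <-]] Oz]] := BTT E oE _ _ y By _ nO'.
  - by exists e.
  - by move=> ? [].
  exists (act (phi h) (subflow_val z : X)); split; last exact: Oz.
  apply: (@act_setM _ _ V1 V V2) => [v w /VV2|]; first exact: V2V2.
  by exists (phi h) => //; exists (subflow_val z).
apply: subset_trans (@subIsetl _ _ _) _.
apply: subset_trans VJ _.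
apply: subset_trans (closureS (act_setS (@subset_refl _ V2) BE')) _.
by apply: act_set_closureM => v w /V2V1; exact: V1V1.
Qed.

(** The converse transfer, from [X] to [N].  Given a TT set [C] inside the
    interior of the closure of V (N \cap A), the set V C \cap A meets [N].  For an
    open [D] in it meeting [N], [presyndetic_interior] applied to [D] yields an
    open subset [E] of [C] within V1 (N \cap D) up to closure, and [C] is
    contained in the closure of V E.  The closure here is taken in [X], and the
    translations are from the whole of [G]. *)
Lemma presyndetic_ambient_TT (U : set G) (A : set X) : densely_TT X ->
  symmetric_open_nbhs1 U -> open A -> N `&` A !=set0 ->
  exists B, [/\ open B, N `&` B !=set0, B `<=` A &
    forall D, open D -> N `&` D !=set0 -> D `<=` B ->
      N `&` B `<=` closure (act_set U (N `&` D))].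
Proof.
move=> tX sU oA NA.
have [V0 [sV0 V0U V00]] := nbhs1_root sU.
have [V1 [sV1 V10 V11]] := nbhs1_root sV0.
have [V2 [sV2 V21 V22]] := nbhs1_root sV1.
have [V [sV VV2 VV]] := nbhs1_root sV2.
have [_ _ iV] := sV.
have intP B : open B -> N `&` B !=set0 ->
    let J := interior (closure (act_set V (N `&` B))) in
    [/\ open J, J !=set0, act_set V J `&` (N `&` B) !=set0 &
      J `<=` closure (act_set V (N `&` B))].
  move=> oB NB J; have J0 : J !=set0 by exact: presyndetic_interior.
  have oJ : open J by exact: open_interior.
  have Jcl : J `<=` closure (act_set V (N `&` B)) by exact: interior_subset.
  split=> //; have [i Ji] := J0.
  exact: meet_act_set iV (closure_meet_open (Jcl _ Ji) oJ Ji).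
have [oJ J0 _ JA] := intP A oA NA.
have [C CJ [oC [c Cc] CTT]] := tX V sV _ oJ J0.
have VC0 : act_set V C `&` (N `&` A) !=set0.
  exact: meet_act_set iV (closure_meet_open (JA _ (CJ _ Cc)) oC Cc).
exists (act_set V C `&` A); split.
- by apply: openI => //; exact: open_act_set.
- by have [x [VCx [Nx Ax]]] := VC0; exists x.
- by move=> ? [].
move=> D oD [d [Nd Dd]] DB.
have [[v Vv [c' Cc' vc]] _] := DB _ Dd.
pose D' := D `&` act v^-1 @^-1` C.
have oD' : open D'.
  by apply: openI => //; apply: open_comp => // x _; exact: continuous_act.
have ND' : N `&` D' !=set0 by exists d; split=> //; split=> //=; rewrite -vc actK.
have [oJ' _ [e [VJe [Ne [De Ce]]]] J'D] := intP D' oD' ND'.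
set J' := interior _ in oJ' VJe J'D.
pose E := C `&` act v @^-1` act_set V J'.
have oE : open E.
  apply: openI => //; apply: open_comp; last exact: open_act_set.
  by move=> x _; exact: continuous_act.
have ED : E `<=` closure (act_set V1 (N `&` D)).
  move=> x [_ VJx].
  have cl2 : closure (act_set V2 (N `&` D')) (act v x).
    have := subset_closure (act_setS (@subset_refl _ V) J'D VJx).
    exact: act_set_closureM.
  have : act_set V (closure (act_set V2 (N `&` D'))) x.
    by exists v^-1; [exact: iV|exists (act v x) => //; rewrite actK].
  move=> /subset_closure/(act_set_closureM (fun p q Vp => V22 p q (VV2 p Vp))).
  by apply: closureS; apply: act_setS => // y [Ny [Dy _]].
have CD : C `<=` closure (act_set V0 (N `&` D)).
  have E0 : E !=set0 by exists (act v^-1 e); split=> //=; rewrite actVK.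
  apply: subset_trans (CTT E oE E0 (@subIsetl _ _ _)) _.
  apply: subset_trans (closureS (act_setS (@subset_refl _ V) ED)) _.
  by apply: act_set_closureM => p q /VV2/V21; exact: V11.
move=> x [_ [VCx _]].
have := subset_closure (act_setS (@subset_refl _ V) CD VCx).
by apply: act_set_closureM => p q /VV2/V21/V10; exact: V00.
Qed.

End Minimal.

(** Since F V H is all of [G], the invariant set [M] meets the closure of V H in
    S(G) for each V; by compactness some point of [M] is in all of these
    closures, whose intersection is the closure of H. *)
Lemma presyndetic_meets (M : set (samuel_flow G)) : closed M -> M !=set0 ->
  act_invariant M -> M `&` hom_closure phi !=set0.
Proof.
move=> cM [m Mm] iM.
pose P : set (samuel_flow G) := range (samuel_point \o phi).
pose F := filter_from (nbhs (1 : G)) (fun V => M `&` closure (act_set V P)).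
have FF : ProperFilter F.
  apply: filter_from_proper; last first.
    move=> V nV; have [F0 fF0 F0H] := pH nV.
    have sub : (range samuel_point : set (samuel_flow G)) `<=`
        act_set F0 (closure (act_set V P)).
      move=> _ [g _ <-].
      have [_ [f F0f [v Vv <-]] [h Hh <-]] : mul_set (mul_set F0 V) H g.
        by rewrite F0H.
      exists f => //; exists (samuel_point (v * h)).
        apply: subset_closure; exists v => //; exists (samuel_point h).
          by exists (to_subgroup Hh).
        by rewrite samuel_act_point.
      by rewrite samuel_act_point mulgA.
    have clm := closureS sub (@samuel_points_dense G m).
    have [f F0f [p clp fp]] := closed_act_set fF0 (@closed_closure _ _) clm.
    by exists p; split=> //; apply: (act_invariantV (g := f) iM); rewrite fp.
  apply: filter_from_filter; first by exists setT; exact: filterT.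
  move=> V W nV nW; exists (V `&` W); first exact: filterI.
  move=> p [Mp clp]; split; split=> //; apply: closureS clp;
    by apply: act_setS => // ? [].
have cptM : compact M by apply: subclosed_compact (@samuel_compact G) _.
have [|p [Mp clp]] := cptM F FF.
  by exists setT; [exact: filterT|move=> ? []].
exists p; split=> // O nO.
have nO1 : @nbhs _ (samuel_flow G) (act 1 p) O by rewrite act1.
have [V nV [Q nQ VQ]] := act_nbhs nO1.
have [W [oW W1 sW] WV] := nbhs1_sym nV.
have [|q [[_ clq] Qq]] := clp (M `&` closure (act_set W P)) (interior Q) _
    (nbhs_interior nQ).
  by exists W => //; exact: open_nbhs_nbhs.
have [_ [[w Ww [x Px <-]] Qx]] := closure_meet_open clq (open_interior Q) Qq.
exists x; split=> //; rewrite -(actK w x); apply: VQ; last exact: interior_subset.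
exact/WV/sW.
Qed.

End Presyndetic.

(** Translations by elements of [G] close to 1 can be replaced by translations
    from [K].  If [D] and a neighbourhood [P] of [b] were such that no small
    element of [K] moves a point of [D] into [P], their preimages under the
    retraction would meet [phi K] in uniformly separated sets [S] and [T].  But
    [i b] is in the closure of both W S and T. *)
Lemma densely_TT_of_ambient (K G : topologicalGroupType) (phi : cts_hom K G)
    (N : flow K) (i : N -> samuel_flow G) :
    embedding_hom phi -> minimal_flow N ->
    continuous i -> (forall k n, i (act k n) = act (phi k) (i n)) ->
    (forall n, hom_closure phi (i n)) ->
    (forall n A, nbhs n A -> exists2 B, nbhs (i n) B & i @^-1` B `<=` A) ->
    (forall U, symmetric_open_nbhs1 U -> forall A, open A -> A !=set0 ->
      exists B, [/\ open B, B !=set0, B `<=` A &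
      forall D, open D -> D !=set0 -> D `<=` B ->
        i @` B `<=` closure (act_set U (i @` D))]) ->
  densely_TT N.
Proof.
move=> emb mN ci ei Ni ni iTT U sU A oA A0.
have [W' nW' W'U] := emb U (symmetric_open_nbhs sU).
have [W sW WW'] := nbhs1_mul nW'.
have [B [oB B0 BA BTT]] := iTT W sW A oA A0.
exists B => //; split=> // D oD D0 DB b Bb P nP; apply: contrapT => UDP.
have [r [cr er rN ri]] := samuel_retraction ci ei Ni mN.
have [P' nP' P'P] := ni b P nP.
pose S := phi @` [set k | exists2 n, D n & r (samuel_point (phi k)) = i n].
pose T := phi @` [set k | P' (r (samuel_point (phi k)))].
have near_i n Q O : nbhs (i n) Q -> nbhs (i n) O ->
    exists k, O (samuel_point (phi k)) /\ Q (r (samuel_point (phi k))).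
  move=> nQ nO; have nrQ : nbhs (i n) (r @^-1` Q) by apply: cr; rewrite ri.
  have [_ [[k _ <-] [Ok Qk]]] := Ni n _ (filterI nO nrQ).
  by exists k.
have clS : i @` D `<=` closure (samuel_point @` S).
  move=> _ [n Dn <-] O nO.
  have [D' nD' D'D] := ni n D (open_nbhs_nbhs (conj oD Dn)).
  have [k [Ok D'k]] := near_i n _ _ nD' nO.
  exists (samuel_point (phi k)); split=> //; exists (phi k) => //; exists k => //.
  have [|m _ im] := rN (samuel_point (phi k)).
    by apply: subset_closure; exists k.
  by exists m => //; apply: D'D; rewrite /= im.
have clT : closure (samuel_point @` T) (i b).
  move=> O nO; have [k [Ok P'k]] := near_i b _ _ nP' nO.
  by exists (samuel_point (phi k)); split=> //; exists (phi k) => //; exists k.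
have clWS : closure (samuel_point @` (mul_set W S)) (i b).
  have ib : (i @` B) (i b) by exists b.
  have := BTT D oD D0 DB (i b) ib.
  apply: closure_sub; first exact: closed_closure.
  apply: subset_trans (act_setS (@subset_refl _ W) clS) _.
  apply: subset_trans (@act_set_closure _ _ _ _) _.
  apply: closureS => _ [w Ww [_ [s Ss <-] <-]].
  by exists (w * s); [exists w => //; exists s|rewrite samuel_act_point].
apply: (@samuel_separate G W _ _ (i b) (symmetric_open_nbhs sW) _ clWS clT).
move=> w _ Ww [w' Ww' [_ [k [n Dn kn] <-] <-]] [l P'l wkl].
apply: UDP; exists (act (l * k^-1) n).
have Ulk : U (l * k^-1).
  apply: W'U; rewrite homM homV wkl mulgA mulgK; exact: WW'.
split; first by exists (l * k^-1) => //; exists n.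
apply: P'P; rewrite /= ei -kn -er samuel_act_point -homM mulgVK.
exact: P'l.
Qed.

Lemma TMD_presyndetic (G : topologicalGroupType) (H : subgroup G) :
  presyndetic (H : set G) -> TMD (subgroup_type H) <-> TMD G.
Proof.
move=> pH; split=> [tH|tG].
  apply/TMD_iff_minimal => X mX; have [X0 _] := mX.
  have [N mN] := @exists_minimal_flow _ (pullback_flow (incl_hom H) X) X0.
  exact: presyndetic_densely_TT mN tH.
pose phi := incl_hom H.
have emb : embedding_hom phi := @incl_hom_embedding G H.
have [M mM] := exists_minimal_flow (samuel_nonempty G).
have [cM M0 iM _] := mM.
pose X := subflow cM iM.
have mX : minimal_flow X := minimal_subflow cM iM mM.
pose Y : set X := subflow_val @^-1` hom_closure phi.
have [p [Mp Hp]] := presyndetic_meets pH cM M0 iM.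
have [|||N mN NY] := @exists_minimal_set _ (pullback_flow phi X) Y.
- apply: preimage_closed; last exact: closed_closure.
  by move=> x _; exact: continuous_subflow_val.
- by have [y yp] := subflow_val_onto cM iM Mp; exists y; rewrite /Y /= yp.
- by move=> h x; exact: hom_closure_invariant.
have [cN _ iN _] := mN.
pose NH := subflow cN iN.
pose i (n : NH) : samuel_flow G := subflow_val (subflow_val n : X).
have mNH : minimal_flow NH := minimal_subflow cN iN mN.
have ci : continuous i.
  move=> n; apply: (@continuous_comp _ _ _ (@subflow_val _ _ _ cN iN)
    (@subflow_val _ _ _ cM iM)); exact: continuous_subflow_val.
have ei k n : i (act k n) = act (phi k) (i n) by [].
have Ni n : hom_closure phi (i n) by exact: NY (subflow_valP n).
exists NH; first exact (samuel_universal_minimal emb ci ei Ni mNH).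
apply: (densely_TT_of_ambient emb mNH ci ei Ni).
  move=> n A /subflow_nbhs [B /subflow_nbhs [C nC CB] BA].
  by exists C => // m Cm; apply: BA; exact: CB.
move=> U sU A /subflow_open [A0 oA0 ->] [a Aa].
have [|B [oB NB BA BTT]] := presyndetic_ambient_TT pH mX mN
    (TMD_minimal tG mX) sU oA0.
  by exists (subflow_val a); split=> //; exact: subflow_valP.
pose v : NH -> X := subflow_val.
have lift x : N x -> exists y : NH, v y = x by exact: subflow_val_onto.
exists (v @^-1` B); split.
- by apply/subflow_open; exists B.
- by have [x [Nx Bx]] := NB; have [y yx] := lift x Nx; exists y; rewrite /= yx.
- by move=> x /BA.
move=> D /subflow_open [D0 oD0 DE'] [d Dd] DB.
have DE : D = v @^-1` D0 by exact: DE'.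
pose D1 := D0 `&` B.
have Dn : N `&` D1 = v @` D.
  apply/seteqP; split=> x.
    move=> [Nx [Dx _]]; have [y yx] := lift x Nx; exists y => //.
    by rewrite DE /= yx.
  move=> [y Dy <-]; split; first exact: subflow_valP.
  by split; [rewrite DE in Dy|exact: DB].
move=> _ [b Bb <-].
have clb : closure (act_set U (N `&` D1)) (v b).
  apply: BTT; first exact: openI.
  - by rewrite Dn; exists (v d), d.
  - by move=> ? [].
  - by split=> //; exact: subflow_valP.
rewrite Dn in clb.
have -> : i @` D = subflow_val @` (v @` D) by rewrite image_comp.
rewrite -(@image_act_set _ X _ (@subflow_val _ _ _ cM iM)) //.
by apply: image_closure; [exact: continuous_subflow_val|exists (v b)].
Qed.

Lemma CMD_coprecompact (G : topologicalGroupType) (H : subgroup G) :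
  coprecompact (H : set G) -> CMD (subgroup_type H) -> CMD G.
Proof.
by move=> cH tH; apply/CMD_iff_minimal => X; exact: G_finite_coprecompact tH.
Qed.

(** * Locally compact groups *)
Section LocallyCompact.
Context (G : topologicalGroupType).
Implicit Types (V C K : set G) (g : G).

Lemma compact_mul_set (A B : set G) :
  compact A -> compact B -> compact (mul_set A B).
Proof.
move=> cA cB.
rewrite (_ : mul_set A B = (fun x : G * G => x.1 * x.2) @` (A `*` B)).
  apply: continuous_compact; last exact: compact_setX.
  by apply: continuous_subspaceT; exact: mulg_continuous.
apply/seteqP; split=> x.
  by move=> [a Aa [b Bb <-]]; exists (a, b).
by move=> [[a b] [/= Aa Bb] <-]; exists a => //; exists b.
Qed.

(** Here [g] avoids the compact set C C C, which contains V V V; this is what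
    makes one-point sets displaced. *)
Section Free.
Variables (V C : set G) (g : G).
Hypotheses (sV : symmetric_open_nbhs1 V) (VC : V `<=` C) (cC : compact C).
Hypothesis ng : ~ mul_set (mul_set C C) C g.

(** This says that V (V P) and g (V P) are disjoint; the set V P will be a colour
    class. *)
Definition displaced (P : set G) := forall x y a b c,
  P x -> P y -> V a -> V b -> V c -> a * b * x <> g * c * y.

(** A set containing x y^-1 for all points x and y in conflict; it is compact,
    which bounds the degrees of the conflict graph. *)
Let L := mul_set (mul_set C C) (mul_set [set g] C) `|`
         mul_set (mul_set C [set g^-1]) (mul_set C C).

Lemma not_displaced x y a b c : V a -> V b -> V c ->
  a * b * x = g * c * y -> L (x * y^-1) /\ L (y * x^-1).
Proof.
have [_ _ iV] := sV.
move=> Va Vb Vc e.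
have xE : x * y^-1 = b^-1 * a^-1 * (g * c).
  by apply: (@mulgI _ (a * b)); apply: (@mulIg _ y); rewrite !mulgA mulgVK
    mulgK mulgV mul1g e.
split.
  left; rewrite xE; exists (b^-1 * a^-1).
    by exists b^-1; [exact/VC/iV|exists a^-1 => //; exact/VC/iV].
  by exists (g * c) => //; exists g => //; exists c => //; exact: VC.
right; exists (c^-1 * g^-1).
  by exists c^-1; [exact/VC/iV|exists g^-1].
exists (a * b); first by exists a; [exact: VC|exists b => //; exact: VC].
rewrite -[RHS]invgK [in RHS]invgM invgK xE !invgM !invgK.
by rewrite !mulgA.
Qed.

Lemma displaced_maximal E : exists P, [/\ displaced P, P `<=` E &
  forall x, E x -> P x \/ exists2 z, P z & L (z * x^-1)].
Proof.
have [F FQ Ftot|P [[dP PE] Pmax]] :=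
    @Zorn_bigcup G [set P | displaced P /\ P `<=` E].
  split; last by move=> x [P /FQ [_ PE] /PE].
  move=> x y a b c [P FP Px] [Q FQ' Qy].
  have [PQ|QP] := Ftot _ _ FP FQ'.
    by have [dQ _] := FQ _ FQ'; apply: dQ => //; exact: PQ.
  by have [dP _] := FQ _ FP; apply: dP => //; exact: QP.
exists P; split=> // x Ex; have [Px|nPx] := pselect (P x); [by left|right].
apply: contrapT => nz; apply: (Pmax (P `|` [set x])).
  split; first by left.
  by move=> /(_ x) h; apply: nPx; apply: h; right.
split; last by move=> y [/PE //|->].
move=> y z a b c [Py|->] [Pz|->] Va Vb Vc e.
- exact: dP Py Pz Va Vb Vc e.
- by have [Lx _] := not_displaced Va Vb Vc e; apply: nz; exists y.
- by have [_ Lx] := not_displaced Va Vb Vc e; apply: nz; exists z.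
apply: ng; exists (a * b).
  by exists a; [exact: VC|exists b => //; exact: VC].
exists c^-1; first by have [_ _ iV] := sV; exact/VC/iV.
by move/mulIg: e => ->; rewrite mulgK.
Qed.

(** Greedy colouring: repeatedly pick a maximal displaced set among the points
    not yet covered.  A point [x] left uncovered after [n] rounds conflicts with
    some z_i of each round; no z_j is in V z_i for i < j, so the elements
    z_i x^-1 of [L] lie in distinct translates of a smaller neighbourhood [W],
    and [n] is at most the number [size t] of translates that cover [L]. *)
Lemma displaced_cover : exists s : seq (set G),
  (forall P, P \in s -> displaced P) /\
  forall x, exists2 P, P \in s & mul_set V P x.
Proof.
have [W sW WW] := nbhs1_mul (symmetric_open_nbhs sV).
have [oW W1 iW] := sW.
have cL : compact L.
  by apply: compactU; do !apply: compact_mul_set => //; exact: compact_set1.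
have [x Lx|F fF FL] := compact_finite_cover (f := fun a => [set x | W (x * a^-1)]) cL.
  exists x; have := nbhs_mulgr x^-1 (symmetric_open_nbhs sW).
  by rewrite invgK mul1g.
have [t Ft] := (finite_seqP F).1 fF.
suff step n : exists s : seq (set G), (forall P, P \in s -> displaced P) /\
    forall x, (exists2 P, P \in s & mul_set V P x) \/
    exists us, [/\ uniq us, size us = n, {subset us <= t} &
      forall u, u \in us -> exists z,
        (exists2 P, P \in s & P z) /\ W (z * x^-1 * u^-1)].
  have [s [ds sV']] := step (size t).+1; exists s; split=> // x.
  have [//|[us [uus sz sub _]]] := sV' x.
  by have := uniq_leq_size uus sub; rewrite sz ltnn.
elim: n => [|n [s [ds IH]]].
  by exists [::]; split=> // x; right; exists [::].
pose E := [set x | ~ exists2 P, P \in s & mul_set V P x].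
have [P [dP PE Pmax]] := displaced_maximal E.
have [_ V1 iV] := sV.
exists (P :: s); split.
  by move=> Q; rewrite inE => /orP [/eqP ->|/ds].
move=> x; have [[Q Qs QVx]|[us [uus sz sub usP]]] := IH x.
  by left; exists Q => //; rewrite inE Qs orbT.
have [Ex|/contrapT [Q Qs QVx]] := pselect (E x); last first.
  by left; exists Q => //; rewrite inE Qs orbT.
have [Px|[z Pz Lzx]] := Pmax x Ex.
  left; exists P; first by rewrite inE eqxx.
  by exists 1 => //; exists x => //; rewrite mul1g.
right; have [u Fu Wu] := FL _ Lzx.
exists (u :: us); split.
- rewrite /= uus andbT; apply/negP => /usP [z' [[Q Qs Qz'] Wz']].
  apply: (PE _ Pz); exists Q => //; exists (z * z'^-1); last first.
    by exists z' => //; rewrite mulgVK.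
  have -> : z * z'^-1 = (z * x^-1 * u^-1) * (z' * x^-1 * u^-1)^-1.
    by rewrite !invgM !invgK !mulgA !mulgVK.
  by apply: WW => //; exact: iW.
- by rewrite /= sz.
- by move=> w; rewrite inE => /orP [/eqP ->|/sub //]; rewrite Ft in Fu.
- move=> w; rewrite inE => /orP [/eqP ->|/usP [z' [[Q Qs Qz'] Wz']]].
    by exists z; split=> //; exists P => //; rewrite inE eqxx.
  by exists z'; split=> //; exists Q => //; rewrite inE Qs orbT.
Qed.

(** The case of Veech's theorem that is needed: [p] is in the closure of some
    colour class, [act g p] in that of its image under [g], and these are
    uniformly separated. *)
Lemma samuel_free (p : samuel_flow G) : act g p <> p.
Proof.
have [s [ds sc]] := displaced_cover => gp.
have [P Ps clP] : exists2 P, P \in s & closure (samuel_point @` mul_set V P) p.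
  have : closure (\bigcup_(P in [set` s]) closure (samuel_point @` mul_set V P)) p.
    apply: closureS (@samuel_points_dense G p) => _ [x _ <-].
    have [P Ps VPx] := sc x; exists P => //.
    by apply: subset_closure; exists x.
  case/(closed_bigcup (finite_seq s) (fun P _ => @closed_closure _ _)) => P.
  by exists P.
apply: (@samuel_separate G V (mul_set V P) [set g * x | x in mul_set V P] p).
- exact: symmetric_open_nbhs.
- move=> a _ Va [b Vb [x Px <-]] [_ [c Vc [y Py <-]]].
  by rewrite !mulgA => e; apply: (ds P Ps x y a b c).
- exact: clP.
rewrite -gp => O nO.
have [_ [[x VPx <-] Ox]] := clP _ (@continuous_act G (samuel_flow G) g p O nO).
exists (samuel_point (g * x)); split; last by rewrite -samuel_act_point.
by exists (g * x) => //; exists x.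
Qed.

End Free.

Lemma TMD_locally_compact :
  locally_compact [set: G] -> TMD G -> compact [set: G].
Proof.
move=> lG [M [mM uM] tM].
have [C nC cC] : exists2 C, nbhs (1 : G) C & compact C.
  have [C nC [cC _]] := lG 1 I; exists C => //.
  by apply: (@filterS _ (nbhs (1 : G)) _ [set x | [set: G] x -> C x]) => [x|]; [exact|exact: nC].
have [V sV VC] := nbhs1_sym nC.
have [M0 dM] := mM.
have [B _ [oB [x Bx] BTT]] := tM V sV setT openT M0.
have BCx y : B y -> exists2 c, C c & act c x = y.
  move=> By; apply: contrapT => nc.
  have [|[O Q] /= [nO nQ] OQ] := (compact_near_coveringP C).1 cC (M * M)%type
      (filter_prod (nbhs x) (nbhs y)) (fun p c => act c p.1 <> p.2).
    move=> c Cc; have hM : hausdorff_space M by have [] := @flow_T3 _ M.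
    have : act c x <> y by move=> cx; apply: nc; exists c.
    move=> /(hausdorff_separate hM) [R nR [Q nQ RQ]].
    have [V' nV' [O nO VO]] := act_nbhs nR.
    exists (V', O `*` Q) => /=; first by split=> //; exists (O, Q).
    move=> [d [z w]] [/= V'd [Oz Qw]] e; apply: (RQ w) => //.
    by rewrite -e; exact: VO.
  have [|||_ [[v Vv [z [_ Oz] <-]] Qz]] := BTT (B `&` interior O) _ _ _ y By _ nQ.
  - by apply: openI => //; exact: open_interior.
  - by exists x.
  - by move=> ? [].
  by apply: (OQ (z, act v z) _ v (VC _ Vv)); split=> //=; exact: interior_subset.
have [|F fF FB] := minimal_set_cover ((minimal_set_setT M).1 mM) oB.
  by exists x.
have [N mN] := exists_minimal_flow (samuel_nonempty G).
have [cN _ iN _] := mN.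
have [h [ch eh _]] := uM _ (minimal_subflow cN iN mN).
have stab g : act g x = x -> mul_set (mul_set C C) C g.
  move=> gx; apply: contrapT => ng.
  apply: (samuel_free sV VC cC ng (p := subflow_val (h x))).
  by rewrite -subflow_val_act -eh gx.
pose K := mul_set (mul_set [set f^-1 | f in F] C) (mul_set (mul_set C C) C).
have cK : compact K.
  do !apply: compact_mul_set => //; apply: finite_compact.
  exact: finite_image.
rewrite (_ : setT = K) //; apply/seteqP; split=> // g _.
have [f Ff Bf] := FB (act g x) I.
have [c Cc cx] := BCx _ Bf.
exists (f^-1 * c); first by exists f^-1; [exists f|exists c].
exists (c^-1 * f * g); last by rewrite !mulgA mulgK mulVg mul1g.
by apply: stab; rewrite !actM -cx actK.
Qed.

End LocallyCompact.

Theorem theorem10p6 (G : topologicalGroupType) (sepG : T3_space G) :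
  [/\ locally_compact [set: G] -> ~ compact [set: G] -> ~ TMD G,
      forall H : subgroup G, closed (H : set G) -> presyndetic (H : set G) ->
        (TMD (subgroup_type H) <-> TMD G)
    & forall H : subgroup G, closed (H : set G) -> coprecompact (H : set G) ->
        CMD (subgroup_type H) -> CMD G].
Proof.
split.
- by move=> lG ncG /(TMD_locally_compact lG).
- by move=> H _; exact: TMD_presyndetic.
- by move=> H _; exact: CMD_coprecompact.
Qed.
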